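(* Let $\mu$ be a Borel probability measure on $\Omega$. Then $\mathbb{P}_\mu$ is exact dimensional (with respect to the metric $d$) and $$ \dim_H(\mathbb{P}_\mu) = (q-1)^2 \sum_{p=1}^j \frac{H^\mu_{m_2}(\alpha^1_p)}{q^{p+1}} + (q-1)(q^{j+1} \gamma - 1) \sum_{p=j+1}^\infty \frac{H^\mu_{m_2}(\alpha^2_{p-j} \lor \alpha^1_p)}{q^{p+1}} + (q-1)(1-q^j \gamma) \sum_{p=j+1}^\infty \frac{H^\mu_{m_2}(\alpha^2_{p-j-1} \lor \alpha^1_p)}{q^p}. $$
   Context: Setting. Let $q\ge 2$ and $m_1>m_2\ge 2$ be integers, $\mathcal{A}_i=\{0,\dots,m_i-1\}$, $\mathbb{N}^*=\{1,2,\dots\}$, $\Sigma_{m_1,m_2}=(\mathcal{A}_1\times\mathcal{A}_2)^{\mathbb{N}^*}$, with elements $(x,y)=(x_k,y_k)_{k\ge1}$. Put $\gamma=\log(m_2)/\log(m_1)$, $L(n)=\lceil n/\gamma\rceil$, and let $j$ be the unique non-negative integer with $q^j\le 1/\gamma<q^{j+1}$. Metric: $d((x,y),(u,v))=\max\left(m_1^{-\min\{k\ge0:(x_{k+1},y_{k+1})\ne(u_{k+1},v_{k+1})\}},\ m_1^{-\gamma\min\{k\ge0:y_{k+1}\ne v_{k+1}\}}\right)$ (with $m_1^{-\infty}=0$). The closed ball of radius $m_1^{-n}$ centred at $(x,y)$ is $B_n(x,y)=\{(u,v): u_k=x_k\ \forall 1\le k\le n,\ v_k=y_k\ \forall 1\le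 k\le L(n)\}$. A Borel probability measure $\nu$ on $\Sigma_{m_1,m_2}$ is exact dimensional, with $\dim_H(\nu)=D$, if $\lim_{n\to\infty}-\frac1n\log_{m_1}\nu(B_n(x,y))=D$ for $\nu$-almost every $(x,y)$. Let $\Omega\subset\Sigma_{m_1,m_2}$ be a nonempty closed set (product topology), and $X_\Omega=\{(x_k,y_k)_{k\ge1}\in\Sigma_{m_1,m_2}:(x_{iq^\ell},y_{iq^\ell})_{\ell\ge0}\in\Omega\ \text{for all } i\ge1 \text{ with } q\nmid i\}$. The measure $\mathbb{P}_\mu$. For a Borel probability measure $\mu$ on $\Omega$ (viewed as a measure on $\Sigma_{m_1,m_2}$), $\mathbb{P}_\mu$ is the unique Borel probability measure on $\Sigma_{m_1,m_2}$ (it is supported on $X_\Omega$) such that for every $(x,y)$ and $n\ge1$, $\mathbb{P}_\mu([(x_1,y_1)\cdots(x_n,y_n)])=\prod_{i\le n,\ q\nmid i}\mu([(x_i,y_i)(x_{qi},y_{qi})\cdots(x_{q^ri},y_{q^ri})])$, where in each factor $r$ is defined by $q^ri\le n<q^{r+1}i$, and $[w]$ denotes the set of sequences starting with the word $w$. Partitions and entropy. For $p\ge1$, $\alpha^1_p$ is the partition of $\Omega$ according to the values of $(y_1,\dots,y_p)$, and $\alpha^2_p$ is the partition of $\Omega$ according to the values of $((x_1,y_1),\dots,(x_p,y_p))$; $\alpha^2_0=\{\Omega\}$ is the trivial partition. $\lor$ is the common refinement. For a finite measurable partition $\mathcal{P}$ of $\Omega$, $H^\mu_{m_2}(\mathcal{P})=-\sum_{C\in\mathcal{P}}\mu(C)\log_{m_2}\mu(C)$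 (with $0\log 0=0$). *)

(* Defs.v *)
From HB Require Import structures.
From mathcomp Require Import all_boot all_order all_algebra.
From mathcomp Require Import all_classical all_reals all_analysis.

Set Implicit Arguments.
Unset Strict Implicit.
Unset Printing Implicit Defensive.

Import Order.TTheory GRing.Theory Num.Theory.

Local Open Scope classical_set_scope.
Local Open Scope ring_scope.

(* {0, ..., m - 1} for m >= 1; the shape n.+1 makes it pointed, as required of
   the carrier of a measurable space. *)
Definition alphabet (m : nat) : Type := 'I_m.-1.+1.

HB.instance Definition _ m := Finite.on (alphabet m).
HB.instance Definition _ m := isPointed.Build (alphabet m) ord0.

Definition letter (m1 m2 : nat) : Type := (alphabet m1 * alphabet m2)%type.

HB.instance Definition _ m1 m2 := Finite.on (letter m1 m2).
HB.instance Definition _ m1 m2 := Pointed.on (letter m1 m2).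

(* Sequences over N* = {1, 2, ...} are represented by functions on nat, the
   value at k : nat being the term of index k + 1; the term of index k >= 1 of
   z is thus z k.-1. *)
Definition Sigma (m1 m2 : nat) : Type :=
  prod_topology (fun _ : nat => discrete_topology (letter m1 m2)).

HB.instance Definition _ m1 m2 := Topological.on (Sigma m1 m2).
HB.instance Definition _ m1 m2 := Pointed.on (Sigma m1 m2).
HB.instance Definition _ m1 m2 :=
  Measurable.copy (Sigma m1 m2) (g_sigma_algebraType (@open (Sigma m1 m2))).

Section Metric.
Variables (R : realType) (m1 m2 : nat).
Implicit Types (z w : Sigma m1 m2) (n : nat).

Definition gamma : R := ln m2%:R / ln m1%:R.

Definition L n : nat := `|Num.ceil (n%:R / gamma)|%N.

(* m1 to the power - c * min {k >= 0 | u_(k+1) <> v_(k+1)}, and 0 if u = v. *)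
Definition diff_pow (c : R) (T : eqType) (u v : nat -> T) : R :=
  if pselect (exists k, u k != v k) is left neq_uv
  then m1%:R `^ (- (c * (ex_minn neq_uv)%:R)) else 0.

Definition dist z w : R :=
  Num.max (diff_pow 1 z w) (diff_pow gamma (fun k => (z k).2) (fun k => (w k).2)).

Definition ball_at n z : set (Sigma m1 m2) := [set w | dist z w <= m1%:R ^- n].

Lemma diff_powP (c : R) (T : eqType) (u v : nat -> T) n :
  (1 < m1)%N -> 0 <= c ->
  diff_pow c u v <= m1%:R ^- n <->
  (forall k, c * k%:R < n%:R -> u k = v k).
Proof.
move=> m1_gt1 c0; have m1R : 1 < m1%:R :> R by rewrite ltr1n.
rewrite /diff_pow; case: pselect => [neq_uv|eq_uv]; last first.
  split=> [_ k _|_]; last by rewrite invr_ge0 exprn_ge0.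
  by apply/eqP/negPn/negP => uvk; apply: eq_uv; exists k.
case: ex_minnP => k uvk kmin.
rewrite -powR_mulrn // -powRN /powR gt_eqF ?ltr0n 1?ltnW// ler_expR.
rewrite ler_pM2r ?ln_gt0// lerN2.
split=> [nck i ci|/(_ k) uv].
  apply/eqP/negPn/negP => /kmin ki.
  have := lt_le_trans ci nck.
  by rewrite ltNge ler_wpM2l ?ler_nat.
by rewrite leNgt; apply/negP => /uv /eqP; rewrite (negbTE uvk).
Qed.

Lemma gamma_gt0 : (1 < m2 < m1)%N -> 0 < gamma.
Proof.
by move=> /andP[m2_gt1 lt_m]; rewrite divr_gt0// ln_gt0// ltr1n// (ltn_trans m2_gt1).
Qed.

Lemma gamma_lt1 : (1 < m2 < m1)%N -> gamma < 1.
Proof.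
move=> /andP[m2_gt1 lt_m]; have m1_gt1 := ltn_trans m2_gt1 lt_m.
rewrite ltr_pdivrMr ?mul1r ?ln_gt0 ?ltr1n//.
by rewrite ltr_ln ?posrE ?ltr_nat ?ltr0n// ltnW.
Qed.

Lemma ball_atE n z : (1 < m2 < m1)%N ->
  ball_at n z = [set w |
    (forall k, (k < n)%N -> (w k).1 = (z k).1) /\
    (forall k, (k < L n)%N -> (w k).2 = (z k).2)].
Proof.
move=> hm; have g0 := gamma_gt0 hm; have g1 := gamma_lt1 hm.
have m1_gt1 : (1 < m1)%N by case/andP: hm; exact: ltn_trans.
have LP k : (gamma * k%:R < n%:R) = (k < L n)%N.
  have c0 : 0 <= Num.ceil (n%:R / gamma).
    by rewrite -(ceil0 R) le_ceil// divr_ge0// ltW.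
  by rewrite mulrC -ltr_pdivlMr// -[k%:R]/(k%:~R) -ceil_gt_int -ltz_nat gez0_abs.
have nL : (n <= L n)%N.
  rewrite -(ler_nat R) (le_trans (y := gamma * (L n)%:R))//.
    by rewrite leNgt LP ltnn.
  by rewrite ler_piMl// ltW.
apply/seteqP; split=> w; rewrite /ball_at/= /dist ge_max.
  move=> /andP[/(diff_powP _ _ _ m1_gt1 ler01) zw].
  move=> /(diff_powP _ _ _ m1_gt1 (ltW g0)) zw2.
  split=> k kn; first by rewrite zw// mul1r ltr_nat.
  by rewrite zw2// LP.
move=> [wz1 wz2]; apply/andP; split.
  apply/diff_powP => // k; rewrite mul1r ltr_nat => kn.
  have kL := leq_trans kn nL.
  by rewrite [LHS]surjective_pairing [RHS]surjective_pairing wz1// wz2.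
apply/diff_powP => //; first exact: ltW.
by move=> k; rewrite LP => /wz2 ->.
Qed.

Local Open Scope ereal_scope.

(* lne 0 = -oo, so the term is +oo when the ball has measure 0. *)
Definition exact_dimensional (nu : probability (Sigma m1 m2) R) (D : R) : Prop :=
  {ae nu, forall z,
    (- (n%:R^-1 / ln m1%:R)%:E * lne (nu (ball_at n z))) @[n --> \oo] --> D%:E}.

End Metric.

Section Pmu.
Variables (R : realType) (m1 m2 q : nat).

Definition cylinder (s : seq (letter m1 m2)) : set (Sigma m1 m2) :=
  [set w | mkseq w (size s) = s].

(* The word z_i z_(q i) ... z_(q^r i), where q^r i <= n < q^(r+1) i. *)
Definition orbit_word (z : Sigma m1 m2) (n i : nat) : seq (letter m1 m2) :=
  mkseq (fun l => z (i * q ^ l).-1) (trunc_log q (n %/ i)).+1.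

Lemma orbit_word_exponent n i r : (1 < q)%N -> (0 < i <= n)%N ->
  (q ^ r * i <= n < q ^ r.+1 * i)%N = (r == trunc_log q (n %/ i)).
Proof.
move=> q_gt1 /andP[i0 ni]; rewrite -leq_divRL// -ltn_divLR//.
apply/idP/eqP => [/andP[rn nr]|->]; last by apply: trunc_log_bounds; rewrite ?divn_gt0.
by apply/esym/trunc_log_eq => //; rewrite rn nr.
Qed.

Definition is_Pmu (mu P : probability (Sigma m1 m2) R) : Prop :=
  forall (z : Sigma m1 m2) (n : nat), (1 <= n)%N ->
    P (cylinder (mkseq z n)) =
    (\prod_(1 <= i < n.+1 | ~~ (q %| i)%N) mu (cylinder (orbit_word z n i)))%E.

End Pmu.

Section Entropy.
Variables (R : realType) (m1 m2 : nat).
Implicit Types (Omega : set (Sigma m1 m2)) (P Q : set (set (Sigma m1 m2))).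

Definition partition_by (V : Type) Omega (f : Sigma m1 m2 -> V) :
    set (set (Sigma m1 m2)) :=
  [set Omega `&` f @^-1` [set v] | v in f @` Omega].

Definition alpha1 Omega (p : nat) : set (set (Sigma m1 m2)) :=
  partition_by Omega (fun z => [tuple (z k).2 | k < p]).

Definition alpha2 Omega (p : nat) : set (set (Sigma m1 m2)) :=
  partition_by Omega (fun z => [tuple (z k : letter m1 m2) | k < p]).

Definition refinement P Q : set (set (Sigma m1 m2)) :=
  [set A `&` B | A in P & B in Q] `\ set0.

Definition entropy (mu : probability (Sigma m1 m2) R) P : R :=
  - \sum_(C \in P) fine (mu C) * (ln (fine (mu C)) / ln m2%:R).

Lemma finite_alpha1 Omega p : finite_set (alpha1 Omega p).
Proof. by apply: finite_image; exact: finite_finset. Qed.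

Lemma finite_alpha2 Omega p : finite_set (alpha2 Omega p).
Proof. by apply: finite_image; exact: finite_finset. Qed.

Lemma finite_refinement P Q : finite_set P -> finite_set Q ->
  finite_set (refinement P Q).
Proof. by move=> fP fQ; apply: finite_setD; exact: finite_image2. Qed.

Lemma alpha2_0 Omega : Omega !=set0 -> alpha2 Omega 0 = [set Omega].
Proof.
move=> [z Oz]; apply/seteqP; split=> [_ [t _ <-]|_ ->] /=.
  by apply/seteqP; split=> w; [case|split=> //=; rewrite tuple0 [t]tuple0].
exists [tuple]; first by exists z => //; rewrite tuple0.
by apply/seteqP; split=> w; [case|split=> //=; rewrite tuple0].
Qed.

End Entropy.

(* Main.v *)
Require Import Defs.
From mathcomp Require Import all_boot all_order all_algebra.
From mathcomp Require Import all_classical all_reals all_analysis.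
From mathcomp Require Import measurable_realfun zify ring lra.

Set Implicit Arguments.
Unset Strict Implicit.
Unset Printing Implicit Defensive.

Import Order.TTheory GRing.Theory Num.Theory.
Import numFieldNormedType.Exports.
Local Open Scope classical_set_scope.
Local Open Scope ring_scope.

(** Why the formula holds.

    By [ball_atE] the ball of radius m1^-n around z prescribes both
    coordinates of the letters at the positions k <= n, and only the second
    coordinate at the positions n < k <= L n.  Every position is i * q^l for a
    unique i not divisible by q, so the positions split into chains
    i, i q, i q^2, ..., and the product formula [is_Pmu] says that under Pmu
    the restrictions of z to the chains are independent with common law mu.
    Hence the measure of the ball is the product, over the chains, of the
    measures mu (cell a b _), where a and b are the numbers of positions of
    the chain that are at most n and at most L n ([cell_prob_chains]); and
    - ln Pmu (ball) is a sum of independent random variables, the mean of each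
    being the entropy [cell_entropy mu a b] of the partition attached to (a, b).

    Mean.  From n q^j <= L n <= n q^(j+1) it follows that a is b - j or
    b - j - 1 (with truncated subtraction, [chain_len_window]): these are the
    partitions of the formula.  Each of the conditions that b >= p or that
    a >= p selects the chains whose head lies below an explicit threshold,
    which is proportional to n up to rounding.  This gives the asymptotic
    proportion of chains of each type ([sum_chains_levels],
    [cvg_level_sum]), and it decays like q^-p whereas the entropies grow
    polynomially, so that the limit may be taken term by term ([tannery],
    [cvg_expected_info]).

    Fluctuations.  Independence bounds the variance by the sum of the second
    moments ([variance_sum_chains]).  As p (ln p)^2 is bounded on [0, 1] after
    rescaling p by the number of words, a second moment grows only
    quadratically in b ([word_expectation_sqr_info]), so the variance is O(n)
    ([variance_ball_info]).  Along the squares n = (k+1)^2 the normalized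
    squared deviations therefore have summable expectations and tend to 0
    almost everywhere.  Balls decrease with n, so - ln Pmu (ball) is monotone,
    and since consecutive squares have ratio tending to 1 the convergence
    extends to all n ([cvg_of_squares]). *)

(** * Chains of positions with ratio q *)
Section Chains.
Variable q : nat.
Hypothesis q_gt1 : (1 < q)%N.

(** The chains that start at or before M, each represented by its first position. *)
Definition heads (M : nat) : seq nat :=
  [seq i <- index_iota 1 M.+1 | ~~ (q %| i)%N].

(** The number of l with i * q^l <= n: on the range 0 < i <= n this is the
    length of [orbit_word z n i].  Being 0 for i > n, it lets all sums and
    products below range over a fixed set of chains, including those that have
    not started yet. *)
Definition chain_len (n i : nat) : nat :=
  if (i <= n)%N then (trunc_log q (n %/ i)).+1 else 0%N.

Lemma heads_uniq M : uniq (heads M).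
Proof. by rewrite filter_uniq// iota_uniq. Qed.

Lemma mem_heads M i : (i \in heads M) = [&& (0 < i)%N, (i <= M)%N & ~~ (q %| i)%N].
Proof. by rewrite mem_filter mem_index_iota ltnS andbC andbA. Qed.

Lemma heads_gt0 M i : i \in heads M -> (0 < i)%N.
Proof. by rewrite mem_heads => /andP[]. Qed.

Lemma chain_lenP n i l : (0 < i)%N -> (l < chain_len n i)%N = (i * q ^ l <= n)%N.
Proof.
move=> i0; rewrite /chain_len; case: (leqP i n) => [le_in|lt_ni].
  have d0 : (0 < n %/ i)%N by rewrite divn_gt0.
  rewrite ltnS mulnC -leq_divRL//; apply/idP/idP => [le_l|].
    by apply: leq_trans (trunc_logP q_gt1 d0); rewrite leq_exp2l.
  exact: trunc_log_max.
rewrite ltn0; apply/esym/negbTE; rewrite -ltnNge (leq_trans lt_ni)//.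
by rewrite leq_pmulr// expn_gt0 ltnW.
Qed.

Lemma chain_len_gt0 n i : (0 < i <= n)%N -> (0 < chain_len n i)%N.
Proof. by move=> /andP[i0 le_in]; rewrite chain_lenP// muln1. Qed.

Lemma chain_len_leq n i b : (0 < i)%N -> (chain_len n i <= b)%N = (n < i * q ^ b)%N.
Proof. by move=> i0; rewrite leqNgt chain_lenP// -ltnNge. Qed.

Lemma chain_len_mono n N i : (n <= N)%N -> (0 < i)%N ->
  (chain_len n i <= chain_len N i)%N.
Proof.
move=> nN i0; rewrite leqNgt chain_lenP//; apply/negP => h.
by have := leq_trans h nN; rewrite -chain_lenP// ltnn.
Qed.

Lemma chain_decomposition n : (0 < n)%N ->
  exists i l, [/\ (0 < i)%N, ~~ (q %| i)%N & n = (i * q ^ l)%N].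
Proof.
have [m] := ubnP n; elim: m n => // m IH n; rewrite ltnS => le_nm n0.
have [/dvdnP[k def_n]|qNn] := boolP (q %| n)%N; last first.
  by exists n, 0%N; rewrite muln1.
have k0 : (0 < k)%N by move: n0; rewrite def_n; case: k {def_n}.
have lt_kn : (k < n)%N by rewrite def_n ltn_Pmulr.
have [i [l [i0 qNi def_k]]] := IH k (leq_trans lt_kn le_nm) k0.
by exists i, l.+1; split=> //; rewrite def_n def_k expnSr mulnA.
Qed.

Lemma chain_decomposition_inj i i' l l' : (0 < i)%N -> (0 < i')%N ->
  ~~ (q %| i)%N -> ~~ (q %| i')%N -> (i * q ^ l = i' * q ^ l')%N -> i = i'.
Proof.
move=> i0 i'0.
wlog le_l : i i' l l' i0 i'0 / (l <= l')%N => [th|].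
  case: (leqP l l') => [|/ltnW] ll' qi qi' e; first exact: (th _ _ l l').
  by apply/esym; exact: (th _ _ l' l).
rewrite -(subnKC le_l) expnD mulnA mulnAC => qNi qNi' /eqP.
rewrite eqn_pmul2r ?expn_gt0 1?ltnW// => /eqP def_i.
move: def_i qNi; case: (l' - l)%N => [->|k ->]; first by rewrite muln1.
by rewrite expnS dvdn_mull ?dvdn_mulr.
Qed.

(** Lengthening the window by one position lengthens by one letter the unique
    chain through that position, and no other. *)
Lemma chain_len_step n i0 l : (0 < i0)%N -> ~~ (q %| i0)%N ->
    n.+1 = (i0 * q ^ l)%N ->
  [/\ chain_len n i0 = l, chain_len n.+1 i0 = l.+1 &
      forall i, (0 < i)%N -> ~~ (q %| i)%N -> i != i0 ->
        chain_len n.+1 i = chain_len n i].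
Proof.
move=> i00 qNi0 def_n.
have eq_len i m k : (0 < i)%N ->
    (forall l', (i * q ^ l' <= m)%N = (l' < k)%N) -> chain_len m i = k.
  move=> i_gt0 H; apply/eqP; rewrite eqn_leq chain_len_leq// ltnNge H ltnn/=.
  by case: k H => // k H; rewrite chain_lenP// H.
have pos_i0 l' : (i0 * q ^ l' <= n.+1)%N = (l' <= l)%N.
  by rewrite def_n leq_pmul2l// leq_exp2l.
split.
- apply: eq_len => // l'; rewrite -ltnS def_n ltn_pmul2l// ltn_exp2l//.
- by apply: eq_len => // l'; rewrite pos_i0.
- move=> i i_gt0 qNi ii0; apply: eq_len => // l'.
  rewrite chain_lenP// leq_eqVlt ltnS; case: eqP => //= e.
  move: ii0; by rewrite (@chain_decomposition_inj i i0 l' l)// ?eqxx// e.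
Qed.

End Chains.

Lemma big_tuple_rcons (R : Type) (idx : R) (op : Monoid.com_law idx)
    (T : finType) n (F : seq T -> R) :
  \big[op/idx]_(t : n.+1.-tuple T) F t =
  \big[op/idx]_(t : n.-tuple T) \big[op/idx]_(a : T) F (rcons t a).
Proof.
rewrite pair_big/=.
pose h (p : n.-tuple T * T) : n.+1.-tuple T := [tuple of rcons p.1 p.2].
pose h' (t : n.+1.-tuple T) := ([tuple of belast (thead t) (behead t)],
                                last (thead t) (behead t)).
rewrite (reindex h) //.
exists h' => [[t a] _|t _].
  rewrite /h/h' /=.
  have e : thead [tuple of rcons t a] :: behead (rcons t a) = rcons t a.
    exact: (esym (congr1 val (tuple_eta [tuple of rcons t a]))).
  have := lastI (thead [tuple of rcons t a]) (behead (rcons t a)).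
  rewrite e => /esym/rcons_inj [e1 e2].
  by congr pair => //; apply: val_inj; rewrite /= e1.
apply: val_inj; rewrite /h/h' /= -lastI.
exact: (esym (congr1 val (tuple_eta t))).
Qed.

Lemma big_tuple0 (R : Type) (idx : R) (op : Monoid.com_law idx)
    (T : finType) (F : seq T -> R) :
  \big[op/idx]_(t : 0.-tuple T) F t = F [::].
Proof.
rewrite (big_pred1 [tuple]) // => t.
by rewrite [t]tuple0; exact/esym/eqP.
Qed.

(** Summing a product of functions of the separate chains over all words of
    length N factorizes.  Induction on N works with no bijection between words
    and families of chain words: the last letter enters a single factor
    ([chain_len_step]), so that the sum over it is absorbed by changing the
    function attached to that chain.  All chains below M are kept throughout,
    those not yet started contributing the constant [g i [::]]. *)
Lemma sum_prod_chains (R : comNzRingType) (T : finType) (x0 : T) (q M : nat)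
    (g : nat -> seq T -> R) (N : nat) : (1 < q)%N -> (N <= M)%N ->
  \sum_(t : N.-tuple T) \prod_(i <- heads q M)
    g i (mkseq (fun l => nth x0 t (i * q ^ l).-1) (chain_len q N i)) =
  \prod_(i <- heads q M) \sum_(s : (chain_len q N i).-tuple T) g i s.
Proof.
move=> q1; elim: N g => [|N IH] g NM.
  rewrite (big_tuple0 _ (fun t => \prod_(i <- heads q M)
    g i (mkseq (fun l => nth x0 t (i * q ^ l).-1) (chain_len q 0 i)))).
  rewrite !big_seq; apply: eq_bigr => i; rewrite mem_heads => /andP[i0 _].
  have -> : chain_len q 0 i = 0%N by rewrite /chain_len leqNgt i0.
  by rewrite big_tuple0.
(* the chain of head i0 is the one through the new position N + 1 = i0 q^l *)
have [i0 [l [i00 qNi0 def_N]]] := chain_decomposition q1 (ltn0Sn N).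
have [len0 lenS lenE] := chain_len_step q1 i00 qNi0 def_N.
have i0M : i0 \in heads q M.
  rewrite mem_heads i00 qNi0 andbT/= (leq_trans _ NM)// def_N.
  by rewrite leq_pmulr// expn_gt0 ltnW.
rewrite (big_tuple_rcons _ _ (fun t => \prod_(i <- heads q M)
    g i (mkseq (fun l => nth x0 t (i * q ^ l).-1) (chain_len q N.+1 i)))).
pose g' i s := if i == i0 then \sum_(a : T) g i (rcons s a) else g i s.
transitivity (\prod_(i <- heads q M)
    \sum_(s : (chain_len q N i).-tuple T) g' i s); last first.
  rewrite !big_seq; apply: eq_bigr => i; rewrite mem_heads => /and3P[ip _ qNi].
  rewrite /g'; have [->|ii0] := eqVneq i i0; last by rewrite lenE.
  by rewrite lenS len0 big_tuple_rcons.
rewrite -IH 1?ltnW//; apply: eq_bigr => t _.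
rewrite (bigD1_seq i0) ?heads_uniq//= /g' eqxx.
under [in RHS]eq_bigr => i /negbTE -> do [].
rewrite big_distrl/=; apply: eq_bigr => a _.
rewrite (bigD1_seq i0) ?heads_uniq//=; congr (_ * _).
  rewrite lenS mkseqS len0; congr (g _ (rcons _ _)); last first.
    by rewrite -def_N/= nth_rcons size_tuple ltnn eqxx.
  apply/eq_in_map => k; rewrite mem_iota/= add0n => lt_kl.
  rewrite nth_rcons size_tuple; case: ltnP => //.
  have : (i0 * q ^ k < i0 * q ^ l)%N by rewrite ltn_pmul2l// ltn_exp2l.
  rewrite -def_N; have : (0 < i0 * q ^ k)%N by rewrite muln_gt0 i00 expn_gt0 ltnW.
  by lia.
rewrite big_seq_cond [RHS]big_seq_cond; apply: eq_bigr => i.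
rewrite mem_heads => /andP[/and3P[ip _ qNi] ii0].
rewrite lenE//; congr (g _ _).
apply/eq_in_map => k; rewrite mem_iota/= add0n chain_lenP// => le_kN.
rewrite nth_rcons size_tuple prednK ?le_kN//.
by rewrite muln_gt0 ip expn_gt0 ltnW.
Qed.

(** * Functions of finitely many letters *)
Section Words.
Variables (R : realType) (m1 m2 : nat).
Local Notation T := (letter m1 m2).
Local Notation Sigma := (Sigma m1 m2).

(** A word is completed by a default letter, so that functions of sequences
    that depend only on a prefix can be evaluated on words. *)
Definition seq_ext (s : seq T) : Sigma := fun k => nth point s k.

Definition depends_on (V : Type) n (F : Sigma -> V) : Prop :=
  forall z w : Sigma, (forall k, (k < n)%N -> z k = w k) -> F z = F w.

Lemma cylinderE (s : seq T) (w : Sigma) :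
  cylinder s w <-> (forall k, (k < size s)%N -> w k = nth point s k).
Proof.
rewrite /cylinder/=; split=> [<- k|H]; first by rewrite size_mkseq => ks; rewrite nth_mkseq.
apply: (@eq_from_nth _ point); rewrite size_mkseq// => k ks.
by rewrite nth_mkseq// H.
Qed.

Lemma measurable_cylinder (s : seq T) : measurable (cylinder s : set Sigma).
Proof.
have -> : (cylinder s : set Sigma) =
    \bigcap_(k in [set k | (k < size s)%N]) [set w | w k = nth point s k].
  by apply/seteqP; split=> w; rewrite cylinderE.
apply: bigcap_measurableType => k _; apply: sub_sigma_algebra.
rewrite (_ : [set w | _] = proj k @^-1` [set nth point s k])//.
apply: open_comp => [z _|]; last exact: discrete_open.
exact: (@proj_continuous _ (fun _ : nat => discrete_topology T)).
Qed.

Lemma seq_extK n (s : n.-tuple T) : mkseq (seq_ext s) n = s.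
Proof.
apply: (@eq_from_nth _ point); rewrite size_mkseq ?size_tuple// => k ks.
by rewrite nth_mkseq.
Qed.

(** Both measurability and the value of the integral are read off this finite
    combination of indicators of cylinders. *)
Lemma depends_on_sumE n (F : Sigma -> R) z : depends_on n F ->
  F z = \sum_(t : n.-tuple T) F (seq_ext t) * \1_(cylinder t) z.
Proof.
move=> dF; rewrite (bigD1 [tuple of mkseq z n])//= big1 => [|t tz].
  rewrite addr0 indicE mem_set ?mulr1; last by rewrite /cylinder/= size_mkseq.
  by apply: dF => k kn; rewrite /seq_ext nth_mkseq.
rewrite indicE memNset ?mulr0//; rewrite /cylinder/= size_tuple => zt.
by move/eqP: tz; apply; apply: val_inj; rewrite /= zt.
Qed.

Lemma depends_on_measurable n (F : Sigma -> R) : depends_on n F ->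
  measurable_fun [set: Sigma] F.
Proof.
move=> dF; rewrite (_ : F = fun z => \sum_(t : n.-tuple T)
    F (seq_ext t) * \1_(cylinder t) z); last first.
  by apply/funext => z; rewrite -depends_on_sumE.
apply: measurable_sum => t; apply: measurable_funM => //.
by apply: measurable_indic; exact: measurable_cylinder.
Qed.

Variable nu : probability Sigma R.

Definition word_prob (s : seq T) : R := fine (nu (cylinder s)).

Lemma word_prob_ge0 s : 0 <= word_prob s.
Proof. exact/fine_ge0/measure_ge0. Qed.

Lemma word_probE s : nu (cylinder s) = (word_prob s)%:E.
Proof. by rewrite fineK// fin_num_measure//; exact: measurable_cylinder. Qed.

(** The expectation of F under the law of the first n letters; it is the
    integral of F when F depends on these letters only
    ([integral_word_expectation]). *)
Definition word_expectation n (F : Sigma -> R) : R :=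
  \sum_(t : n.-tuple T) word_prob t * F (seq_ext t).

Lemma integral_word_expectation n (F : Sigma -> R) :
  depends_on n F -> (forall z, 0 <= F z) ->
  (\int[nu]_z (F z)%:E = (word_expectation n F)%:E)%E.
Proof.
move=> dF F0; under eq_integral => z _ do rewrite (depends_on_sumE z dF) -sumEFin.
rewrite ge0_integral_sum//; last 2 first.
- move=> t; apply/measurable_EFinP/measurable_funM => //.
  by apply: measurable_indic; exact: measurable_cylinder.
- by move=> t z _; rewrite lee_fin mulr_ge0// indicE.
rewrite -sumEFin; apply: eq_bigr => t _.
have mt := measurable_cylinder t.
under eq_integral do rewrite EFinM.
rewrite ge0_integralZl_EFin//; last exact/measurable_EFinP/measurable_indic.
rewrite integral_indic// setIT -[X in (_ * X)%E]/(nu (cylinder t)) word_probE.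
by rewrite -EFinM mulrC.
Qed.

Lemma indic_depends_on n (A : set Sigma) :
  depends_on n A -> depends_on n (\1_A : Sigma -> R).
Proof.
move=> dA z w zw; rewrite !indicE; congr (nat_of_bool _)%:R.
by apply/idP/idP => /set_mem h; apply/mem_set; [rewrite -(dA z w zw)|rewrite (dA z w zw)].
Qed.

Lemma depends_on_measurable_set n (A : set Sigma) : depends_on n A -> measurable A.
Proof. by move=> /indic_depends_on/depends_on_measurable/measurable_indicP. Qed.

Lemma measure_word_expectation n (A : set Sigma) : depends_on n A ->
  nu A = (word_expectation n (\1_A))%:E.
Proof.
move=> dA; rewrite -integral_word_expectation.
- by rewrite integral_indic ?setIT//; exact: (depends_on_measurable_set dA).
- exact: indic_depends_on.
- by move=> z; rewrite indicE.
Qed.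

Lemma word_expectation_cst n c : word_expectation n (fun=> c) = c.
Proof.
rewrite /word_expectation -mulr_suml.
have : nu setT = (word_expectation n (\1_[set: Sigma]))%:E.
  by apply: measure_word_expectation => z w _.
rewrite probability_setT => -[]; rewrite /word_expectation.
by under eq_bigr do rewrite indicE in_setT mulr1; move=> <-; rewrite mul1r.
Qed.

Lemma word_expectationD n F G :
  word_expectation n (fun z => F z + G z) = word_expectation n F + word_expectation n G.
Proof. by rewrite -big_split; apply: eq_bigr => t _; rewrite mulrDr. Qed.

Lemma word_expectationZ n c F :
  word_expectation n (fun z => c * F z) = c * word_expectation n F.
Proof. by rewrite mulr_sumr; apply: eq_bigr => t _; rewrite mulrCA. Qed.

Lemma word_expectation_sum n (I : Type) (r : seq I) (P : pred I) (F : I -> Sigma -> R) :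
  word_expectation n (fun z => \sum_(i <- r | P i) F i z) =
  \sum_(i <- r | P i) word_expectation n (F i).
Proof. by rewrite exchange_big; apply: eq_bigr => t _; rewrite mulr_sumr. Qed.

Lemma ler_word_expectation n F G : (forall t : n.-tuple T, F (seq_ext t) <= G (seq_ext t)) ->
  word_expectation n F <= word_expectation n G.
Proof. by move=> FG; apply: ler_sum => t _; rewrite ler_wpM2l ?word_prob_ge0. Qed.

Lemma word_expectation_ge0 n F : (forall z, 0 <= F z) -> 0 <= word_expectation n F.
Proof. by move=> F0; apply: sumr_ge0 => t _; rewrite mulr_ge0 ?word_prob_ge0. Qed.

(** The atom of the partition according to the first a letters and the first b
    second coordinates.  The ball of radius m1^-n is [cell n (L n) z]. *)
Definition cell (a b : nat) (z : Sigma) : set Sigma := [set w : Sigma |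
  (forall k, (k < a)%N -> (w k).1 = (z k).1) /\
  (forall k, (k < b)%N -> (w k).2 = (z k).2)].

Lemma eq_cell a b z z' : (forall k, (k < a)%N -> (z k).1 = (z' k).1) ->
  (forall k, (k < b)%N -> (z k).2 = (z' k).2) -> cell a b z = cell a b z'.
Proof.
move=> h1 h2; apply/seteqP; split=> w [w1 w2]; split=> k kl.
- by rewrite w1// h1.
- by rewrite w2// h2.
- by rewrite w1// h1.
- by rewrite w2// h2.
Qed.

Lemma depends_on_cell a b z : (a <= b)%N -> depends_on b (cell a b z).
Proof.
move=> ab w w' ww'; apply/propext; split=> -[h1 h2]; split=> k kl.
- by rewrite -ww' ?h1// (leq_trans kl).
- by rewrite -ww' ?h2.
- by rewrite ww' ?h1// (leq_trans kl).
- by rewrite ww' ?h2.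
Qed.

Definition cell_prob a b z : R := fine (nu (cell a b z)).

Lemma cell_probE a b z : (a <= b)%N ->
  nu (cell a b z) = (cell_prob a b z)%:E.
Proof.
move=> /(@depends_on_cell a b z)/depends_on_measurable_set mc.
by rewrite fineK// fin_num_measure.
Qed.

Lemma depends_on_cell_prob a b : (a <= b)%N -> depends_on b (cell_prob a b).
Proof.
move=> ab z w zw; congr (fine (nu _)); apply: eq_cell => k kl; rewrite zw//.
exact: leq_trans kl ab.
Qed.

Lemma cell_prob_ge0 a b z : 0 <= cell_prob a b z.
Proof. exact/fine_ge0/measure_ge0. Qed.

Lemma cell_prob_le1 a b z : (a <= b)%N -> cell_prob a b z <= 1.
Proof.
move=> ab; rewrite -lee_fin -cell_probE//; apply: probability_le1.
exact: depends_on_measurable_set (depends_on_cell _ ab).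
Qed.

Lemma word_prob_le_cell a b (t : b.-tuple T) : (a <= b)%N ->
  word_prob t <= cell_prob a b (seq_ext t).
Proof.
move=> ab; rewrite -lee_fin -cell_probE// -word_probE; apply: le_measure.
- by rewrite inE; exact: measurable_cylinder.
- by rewrite inE; exact: depends_on_measurable_set (depends_on_cell _ ab).
- move=> w /cylinderE; rewrite size_tuple => h; split=> k kl; rewrite h//.
  exact: leq_trans kl ab.
Qed.

End Words.

(** * The product structure of the measure along chains *)
Lemma prod_if_eq (R : comNzRingType) (I : eqType) (r : seq I) (i : I) (x : R) :
  i \in r -> uniq r -> \prod_(k <- r) (if k == i then x else 1) = x.
Proof.
move=> ir ur; rewrite (bigD1_seq i)//= eqxx big1 ?mulr1// => k /negbTE -> //.
Qed.

Section Pmu.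
Variables (R : realType) (m1 m2 q : nat).
Hypothesis q_gt1 : (1 < q)%N.
Local Notation T := (letter m1 m2).
Local Notation Sigma := (Sigma m1 m2).
Variables (mu P : probability Sigma R).
Hypothesis PmuP : is_Pmu q mu P.

(** The restriction of z to the positions i, i q, i q^2, ...; the predecessor
    converts positions numbered from 1 into indices numbered from 0. *)
Definition chain (z : Sigma) (i : nat) : Sigma := fun l => z (i * q ^ l).-1.

Lemma chain_depends_on N i (z w : Sigma) : (0 < i)%N ->
  (forall k, (k < N)%N -> z k = w k) ->
  forall l, (l < chain_len q N i)%N -> chain z i l = chain w i l.
Proof.
move=> i0 zw l; rewrite chain_lenP// => le_N; apply: zw.
by rewrite prednK// muln_gt0 i0 expn_gt0 ltnW.
Qed.

Lemma word_prob_Pmu N (t : N.-tuple T) : (0 < N)%N ->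
  word_prob P t =
  \prod_(i <- heads q N) word_prob mu
    (mkseq (fun l => nth point t (i * q ^ l).-1) (chain_len q N i)).
Proof.
move=> N0; apply: EFin_inj; rewrite -word_probE -[in LHS](seq_extK t) PmuP//.
rewrite -prodEFin [RHS]big_filter/= big_nat_cond [RHS]big_nat_cond.
apply: eq_bigr => i /andP[/andP[i0 iN] _].
by rewrite -word_probE /orbit_word /chain_len -ltnS iN.
Qed.

(** Independence of the chains, each with law mu, in the form of a product rule
    for expectations. *)
Lemma expectation_prod_chains N (h : nat -> Sigma -> R) : (0 < N)%N ->
  (forall i, i \in heads q N -> depends_on (chain_len q N i) (h i)) ->
  word_expectation P N (fun z => \prod_(i <- heads q N) h i (chain z i)) =
  \prod_(i <- heads q N) word_expectation mu (chain_len q N i) (h i).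
Proof.
move=> N0 dh; rewrite /word_expectation.
rewrite -(@sum_prod_chains R T point q N
  (fun i s => word_prob mu s * h i (seq_ext s)) N)//.
apply: eq_bigr => t _; rewrite word_prob_Pmu// -big_split/=.
rewrite !big_seq; apply: eq_bigr => i iN; congr (_ * _).
apply: (dh i iN) => l lt_l.
by rewrite /chain /seq_ext (nth_mkseq point _ lt_l).
Qed.

(** The indicator of a cell is the product of the indicators of its traces on
    the chains, because every position lies on exactly one chain; the product
    rule for expectations then applies. *)
Lemma cell_prob_chains n N z : (n <= N)%N -> (0 < N)%N ->
  cell_prob P n N z =
  \prod_(i <- heads q N) cell_prob mu (chain_len q n i) (chain_len q N i) (chain z i).
Proof.
move=> nN N0; apply: EFin_inj; rewrite -cell_probE//.
rewrite (measure_word_expectation _ (depends_on_cell z nN)).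
pose C i := cell (chain_len q n i) (chain_len q N i) (chain z i).
have dC i : i \in heads q N -> depends_on (chain_len q N i) (C i).
  by rewrite mem_heads => /andP[i0 _]; apply/depends_on_cell/chain_len_mono.
transitivity (\prod_(i <- heads q N) word_expectation mu (chain_len q N i) (\1_(C i)))%:E.
  rewrite -expectation_prod_chains//; last first.
    by move=> i /dC; exact: indic_depends_on.
  congr (word_expectation _ _ _)%:E; apply/funext => w.
  have [wz|nwz] := pselect (cell n N z w).
    rewrite indicE mem_set// big_seq big1// => i; rewrite mem_heads => /andP[i0 _].
    rewrite indicE mem_set//; case: wz => wz1 wz2; split=> l.
      rewrite chain_lenP// => le_l; apply: wz1.
      by rewrite prednK// muln_gt0 i0 expn_gt0 ltnW.
    rewrite chain_lenP// => le_l; apply: wz2.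
    by rewrite prednK// muln_gt0 i0 expn_gt0 ltnW.
  rewrite indicE memNset//; apply/esym/eqP; rewrite prodf_seq_eq0.
  apply/negPn/negP => /hasPn allC; apply: nwz.
  have inC i : i \in heads q N -> C i (chain w i).
    move=> /allC; rewrite /= indicE; case: (boolP (_ \in _)) => [/set_mem//|_].
    by rewrite eqxx.
  have pos k : (k < N)%N -> exists i l,
      [/\ i \in heads q N, k = (i * q ^ l).-1 & (i * q ^ l = k.+1)%N].
    move=> kN; have [i [l [i0 qi ek]]] := chain_decomposition q_gt1 (ltn0Sn k).
    exists i, l; split=> //; last by rewrite -ek.
    rewrite mem_heads i0 qi andbT/= (leq_trans _ kN)// ek.
    by rewrite leq_pmulr// expn_gt0 ltnW.
  split=> k kn.
    have [i [l [iN ek ek']]] := pos k (leq_trans kn nN).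
    have := (inC i iN).1 l; rewrite /chain -ek; apply.
    by move: iN; rewrite mem_heads => /andP[i0 _]; rewrite chain_lenP// ek'.
  have [i [l [iN ek ek']]] := pos k kn.
  have := (inC i iN).2 l; rewrite /chain -ek; apply.
  by move: iN; rewrite mem_heads => /andP[i0 _]; rewrite chain_lenP// ek'.
congr EFin; rewrite !big_seq; apply: eq_bigr => i iN; apply: EFin_inj.
rewrite -measure_word_expectation; last exact: dC.
rewrite cell_probE//; apply: chain_len_mono => //.
by move: iN; rewrite mem_heads => /andP[].
Qed.

Lemma expectation_chain N i (f : Sigma -> R) : i \in heads q N ->
  depends_on (chain_len q N i) f ->
  word_expectation P N (fun z => f (chain z i)) =
  word_expectation mu (chain_len q N i) f.
Proof.
move=> iN df; have N0 : (0 < N)%N.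
  by move: iN; rewrite mem_heads => /and3P[i0 iN _]; exact: leq_trans iN.
pose h k (z : Sigma) : R := if k == i then f z else 1.
transitivity (word_expectation P N (fun z => \prod_(k <- heads q N) h k (chain z k))).
  congr word_expectation; apply/funext => z.
  rewrite -[LHS](prod_if_eq _ iN (heads_uniq q N)).
  by apply: eq_bigr => k _; rewrite /h; case: eqP => // ->.
rewrite expectation_prod_chains//; last first.
  by move=> k kN; rewrite /h; case: eqP => [->//|_ z w _].
rewrite -[RHS](prod_if_eq _ iN (heads_uniq q N)); apply: eq_bigr => k _.
by rewrite /h; case: eqP => [->//|_]; rewrite word_expectation_cst.
Qed.

Lemma expectation_two_chains N i k (f g : Sigma -> R) : i != k ->
  i \in heads q N -> k \in heads q N ->
  depends_on (chain_len q N i) f -> depends_on (chain_len q N k) g ->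
  word_expectation P N (fun z => f (chain z i) * g (chain z k)) =
  word_expectation mu (chain_len q N i) f * word_expectation mu (chain_len q N k) g.
Proof.
move=> ik iN kN df dg; have N0 : (0 < N)%N.
  by move: iN; rewrite mem_heads => /and3P[i0 iN _]; exact: leq_trans iN.
have uN := heads_uniq q N.
pose h e (z : Sigma) : R := (if e == i then f z else 1) * (if e == k then g z else 1).
transitivity (word_expectation P N (fun z => \prod_(e <- heads q N) h e (chain z e))).
  congr word_expectation; apply/funext => z.
  rewrite -(prod_if_eq (f _) iN uN) -(prod_if_eq (g _) kN uN) -big_split/=.
  by apply: eq_bigr => e _; rewrite /h; congr (_ * _); case: eqP => // ->.
rewrite expectation_prod_chains//; last first.
  move=> e eN; rewrite /h; case: eqP => [->|_]; case: eqP => [e_k|_] z w zw.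
  - by rewrite (df _ _ zw) (dg z w)// -e_k.
  - by rewrite (df _ _ zw).
  - by rewrite (dg z w)// -e_k.
  - by [].
rewrite -[X in _ = X * _](prod_if_eq _ iN uN) -[X in _ = _ * X](prod_if_eq _ kN uN).
rewrite -big_split/=; apply: eq_bigr => e _.
rewrite /h; case: (eqVneq e i) => [->|_].
  rewrite (negbTE ik) mulr1; congr word_expectation.
  by apply/funext => z; rewrite mulr1.
rewrite mul1r; case: (eqVneq e k) => [->|_].
  by congr word_expectation; apply/funext => z; rewrite mul1r.
under eq_fun do rewrite mulr1.
exact: word_expectation_cst.
Qed.

(** The square of the centered sum is expanded: mixed terms vanish by
    independence, and a diagonal term is a variance, at most the second
    moment. *)
Lemma variance_sum_chains N (f : nat -> Sigma -> R) :
  (forall i, i \in heads q N -> depends_on (chain_len q N i) (f i)) ->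
  word_expectation P N (fun z => (\sum_(i <- heads q N) f i (chain z i) -
    \sum_(i <- heads q N) word_expectation mu (chain_len q N i) (f i)) ^+ 2) <=
  \sum_(i <- heads q N) word_expectation mu (chain_len q N i) (fun z => f i z ^+ 2).
Proof.
move=> df; pose e i := word_expectation mu (chain_len q N i) (f i).
pose c i z := f i z - e i.
have dc i : i \in heads q N -> depends_on (chain_len q N i) (c i).
  by move=> iN z w zw; rewrite /c (df i iN _ _ zw).
have Ec i : word_expectation mu (chain_len q N i) (c i) = 0.
  by rewrite word_expectationD word_expectation_cst subrr.
rewrite (_ : (fun z => _) = fun z => \sum_(i <- heads q N) \sum_(k <- heads q N)
    c i (chain z i) * c k (chain z k)); last first.
  apply/funext => z; rewrite -sumrB expr2 big_distrl/=.
  by apply: eq_bigr => i _; rewrite big_distrr.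
rewrite word_expectation_sum big_seq [leRHS]big_seq; apply: ler_sum => i iN.
rewrite word_expectation_sum (bigD1_seq i) ?heads_uniq//=.
rewrite big_seq_cond big1 => [|k /andP[kN ki]]; last first.
  by rewrite expectation_two_chains// 1?eq_sym// ?Ec ?mul0r//; exact: dc.
rewrite addr0 (@expectation_chain _ _ (fun z => c i z * c i z))//; last first.
  by move=> z w zw; rewrite (dc i iN _ _ zw).
rewrite (_ : (fun z => _) = fun z => f i z ^+ 2 + (- 2 * e i * f i z + e i ^+ 2)); last first.
  by apply/funext => z; rewrite /c; ring.
rewrite word_expectationD word_expectationD word_expectationZ word_expectation_cst.
rewrite -/(e i) gerDl (_ : _ + _ = - (e i ^+ 2)); last by ring.
by rewrite oppr_le0 sqr_ge0.
Qed.

End Pmu.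

(** * Entropy of the partitions *)
Section EntropyOfCells.
Variables (R : realType) (m1 m2 : nat).
Local Notation T := (letter m1 m2).
Local Notation Sigma := (Sigma m1 m2).
Variables (mu : probability Sigma R) (Omega : set Sigma).
Hypothesis Omega_closed : closed Omega.
Hypothesis mu_Omega : mu Omega = 1%E.

(** The random variable whose expectation is the entropy, in natural units. *)
Definition info a b (z : Sigma) : R := - ln (cell_prob mu a b z).

Definition cell_entropy a b : R := word_expectation mu b (info a b).

Lemma measure_setI_full (A : set Sigma) : measurable A -> mu (Omega `&` A) = mu A.
Proof.
move=> mA; have mO : measurable Omega.
  rewrite -(setCK Omega); apply: measurableC; apply: sub_sigma_algebra.
  exact: closed_openC.
have mC : mu (~` Omega) = 0%E by rewrite probability_setC// mu_Omega subee.
rewrite (measureDI mu mA mO) setIC [X in (X + _)%E](_ : _ = 0%E) ?add0e//.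
apply/eqP; rewrite eq_le measure_ge0 andbT -mC; apply: le_measure.
- by rewrite inE; exact: measurableD.
- by rewrite inE; exact: measurableC.
- by move=> z [].
Qed.

(** The atoms of the partition are indexed by the values of [key]: since mu is
    carried by Omega, values not taken on Omega have probability 0 and
    contribute nothing, which allows a sum over the whole finite type.  Grouping
    words by the value of [key] turns that sum into an expectation. *)
Lemma entropy_partition_by (K : finType) (key : Sigma -> K) b : depends_on b key ->
  entropy mu (partition_by Omega key) =
  word_expectation mu b (fun z => - ln (fine (mu (key @^-1` [set key z])))) / ln m2%:R.
Proof.
move=> dkey; have dK v : depends_on b (key @^-1` [set v]).
  by move=> z w zw; rewrite /preimage/= (dkey z w zw).
pose p v := fine (mu (key @^-1` [set v])).
have pE v : p v = fine (mu (Omega `&` key @^-1` [set v])).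
  by rewrite measure_setI_full//; exact: depends_on_measurable_set (dK v).
rewrite /entropy fsbig_image; last first.
  move=> v w; rewrite !inE => -[z Oz <-] [z' Oz' <-] /seteqP[/(_ z) + _].
  by case=> //.
rewrite fsbig_mkcond (fsbigE (enum K)) ?enum_uniq//; last first.
  by move=> v _; rewrite mem_enum.
rewrite (eq_bigl xpredT) => [|v]; last by rewrite in_setT.
rewrite big_enum/=.
transitivity (\sum_(v : K) - (p v * ln (p v)) / ln m2%:R).
  rewrite -sumrN; apply: eq_bigr => v _; rewrite /patch -pE mulrA.
  case: ifPn => [_|/negP vO]; first by rewrite mulNr.
  rewrite oppr0 (_ : p v = 0) ?mul0r ?oppr0 ?mul0r//.
  rewrite pE (_ : _ `&` _ = set0) ?measure0//; apply/seteqP; split=> z //= [Oz zv].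
  by apply: vO; rewrite inE; exists z.
rewrite -mulr_suml; congr (_ / _); rewrite /word_expectation.
rewrite (partition_big (fun t : b.-tuple T => key (seq_ext t)) xpredT)//=.
apply: eq_bigr => v _; have : mu (key @^-1` [set v]) = (p v)%:E.
  rewrite fineK// fin_num_measure//; exact: depends_on_measurable_set (dK v).
rewrite (measure_word_expectation _ (dK v)) => -[pv].
rewrite -mulrN -{1}pv mulr_suml [RHS]big_mkcond/=; apply: eq_bigr => t _.
case: eqP => [<-|kv]; first by rewrite indicE mem_set// mulr1.
by rewrite indicE memNset// mulr0 mul0r.
Qed.

(** The common refinement of two partitions given by maps is given by the pair of maps. *)
Definition cell_key a b (z : Sigma) : a.-tuple T * b.-tuple (alphabet m2) :=
  ([tuple (z k : T) | k < a], [tuple (z k).2 | k < b]).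

Lemma cell_keyP a b z w : (a <= b)%N ->
  cell_key a b w = cell_key a b z <-> cell a b z w.
Proof.
move=> ab; split=> [e|[h1 h2]].
  split=> k kl.
    have := congr1 (fun p => tnth p.1 (Ordinal kl)) e.
    by rewrite /= !tnth_mktuple => ->.
  have := congr1 (fun p => tnth p.2 (Ordinal kl)) e.
  by rewrite /= !tnth_mktuple.
congr pair; apply: eq_from_tnth => k; rewrite !tnth_mktuple ?h2//.
rewrite [LHS]surjective_pairing [RHS]surjective_pairing h1// h2//.
exact: leq_trans (ltn_ord k) ab.
Qed.

Lemma refinement_partition_by a b :
  refinement (alpha2 Omega a) (alpha1 Omega b) = partition_by Omega (cell_key a b).
Proof.
apply/seteqP; split=> [C [[A [_ [x Ox <-] <-] [B [_ [y Oy <-] <-] CAB]] Cn0]|].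
  have [z Cz] : C !=set0 by apply/set0P/eqP.
  move: Cz; rewrite -CAB => -[[Oz /= zx] [_ /= zy]].
  exists (cell_key a b z); first by exists z.
  rewrite -zx -zy; apply/seteqP; split=> w /=.
    move=> [Ow e]; have /= e1 := congr1 fst e; have /= e2 := congr1 snd e.
    by split; split.
  by move=> [[Ow /= e1] [_ /= e2]]; split=> //; rewrite /cell_key e1 e2.
move=> C [_ [z Oz <-] <-]; split.
  exists (Omega `&` (fun z => [tuple (z k : T) | k < a]) @^-1`
    [set [tuple (z k : T) | k < a]]).
    by exists [tuple (z k : T) | k < a] => //; exists z.
  exists (Omega `&` (fun z => [tuple (z k).2 | k < b]) @^-1`
    [set [tuple (z k).2 | k < b]]).
    by exists [tuple (z k).2 | k < b] => //; exists z.
  apply/seteqP; split=> w /=.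
    by move=> [[Ow /= e1] [_ /= e2]]; split=> //; rewrite /cell_key e1 e2.
  move=> [Ow e]; have /= e1 := congr1 fst e; have /= e2 := congr1 snd e.
  by split; split.
by move=> /seteqP[/(_ z) + _]; apply; split.
Qed.

Lemma entropy_refinement a b : (a <= b)%N ->
  entropy mu (refinement (alpha2 Omega a) (alpha1 Omega b)) =
  cell_entropy a b / ln m2%:R.
Proof.
move=> ab; rewrite refinement_partition_by.
have pre z : cell_key a b @^-1` [set cell_key a b z] = cell a b z.
  by apply/seteqP; split=> w /= /cell_keyP; apply.
rewrite (@entropy_partition_by _ _ b).
  congr (word_expectation _ _ _ / _); apply/funext => z.
  by rewrite pre.
by move=> z w zw; apply/cell_keyP => //; split=> k kl; rewrite zw// (leq_trans kl).
Qed.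

Lemma refinement_alpha2_0 b : Omega !=set0 ->
  refinement (alpha2 Omega 0) (alpha1 Omega b) = alpha1 Omega b.
Proof.
move=> O0; rewrite alpha2_0//; apply/seteqP; split=> C.
  move=> [[_ -> [_ [_ [y Oy <-] <-] <-]] _]; rewrite setIA setIid.
  by exists [tuple (y k).2 | k < b] => //; exists y.
move=> [_ [y Oy <-] <-]; split.
  exists Omega => //; exists (Omega `&` (fun z => [tuple (z k).2 | k < b]) @^-1`
    [set [tuple (y k).2 | k < b]]); last by rewrite setIA setIid.
  by exists [tuple (y k).2 | k < b] => //; exists y.
by move=> /seteqP[/(_ y) + _]; apply; split.
Qed.

End EntropyOfCells.

(** * Moments of the information *)
Section SecondMoment.
Variable R : realType.

(** With t = s^2, the left-hand side is 4 (s ln s)^2, and - ln s = ln (1/s) is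
    at most 1/s. *)
Lemma mul_sqr_ln_le4 (t : R) : 0 < t -> t <= 1 -> t * ln t ^+ 2 <= 4.
Proof.
move=> t0 t1; pose s := Num.sqrt t.
have s0 : 0 < s by rewrite sqrtr_gt0.
have ts : t = s ^+ 2 by rewrite sqr_sqrtr// ltW.
have s1 : s <= 1 by rewrite -sqrtr1 ler_wsqrtr.
have lns : ln s <= 0 by rewrite ln_le0.
have lns' : - ln s <= s^-1.
  rewrite -lnV ?posrE// ltW//; apply: ln_sublinear; by rewrite invr_gt0.
rewrite ts lnXn// mulr2n.
have sl : - (s * ln s) <= 1.
  by rewrite -mulrN mulrC -ler_pdivlMr// div1r.
have sl0 : 0 <= - (s * ln s) by rewrite oppr_ge0 mulr_ge0_le0// ltW.
rewrite (_ : _ * _ = 4 * (s * ln s) ^+ 2); last by ring.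
nra.
Qed.

(** Meant for M the number of words: summed over M words of total probability
    one, the right-hand side gives 8 + 2 (ln M)^2.  If p M > 1 then
    |ln p| <= ln M; otherwise ln p = ln (p M) - ln M, and [mul_sqr_ln_le4]
    controls the first term. *)
Lemma mul_sqr_ln_bound (p M : R) : 0 <= p -> p <= 1 -> 1 <= M ->
  p * ln p ^+ 2 <= 8 / M + 2 * p * ln M ^+ 2.
Proof.
move=> p0 p1 M1; have M0 : 0 < M by apply: lt_le_trans M1.
have iM0 : 0 < 8 / M by rewrite divr_gt0.
have [->|pn0] := eqVneq p 0; first by rewrite mulr0 !mul0r addr0 ltW.
have {p0 pn0} p0 : 0 < p by rewrite lt_neqAle eq_sym pn0.
have lnM0 : 0 <= ln M by rewrite ln_ge0.
have lnp : ln p <= 0 by rewrite ln_le0.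
have lnt : ln (p * M) = ln p + ln M by rewrite lnM ?posrE.
have [t1|t1] := leP (p * M) 1.
  have := mul_sqr_ln_le4 (mulr_gt0 p0 M0) t1; rewrite lnt => h.
  have h' : p * (ln p + ln M) ^+ 2 <= 4 / M by rewrite ler_pdivlMr// mulrAC.
  have -> : 8 / M = 2 * (4 / M) by field; rewrite gt_eqF.
  have : 0 <= p * (ln p + 2 * ln M) ^+ 2 by rewrite mulr_ge0 ?sqr_ge0// ltW.
  nra.
have : 0 <= ln p + ln M by rewrite -lnt ln_ge0// ltW.
move=> h; have : ln p ^+ 2 <= ln M ^+ 2 by nra.
move=> h2; have : p * ln p ^+ 2 <= p * ln M ^+ 2 by rewrite ler_wpM2l// ltW.
have : 0 <= p * ln M ^+ 2 by rewrite mulr_ge0 ?sqr_ge0// ltW.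
by move: iM0; nra.
Qed.

(** Quadratic growth is traded for a geometric one whose ratio, 25/16, stays
    below 2 <= q: this is all that the convergence of the series requires and
    it keeps every tail geometric. *)
Lemma sqr_le_expr (b : nat) : (b.+1%:R : R) ^+ 2 <= 16 * (25 / 16) ^+ b.
Proof.
have h : forall b : nat, (b%:R + 4 : R) <= 4 * (5 / 4) ^+ b.
  elim=> [|n IH]; first by rewrite expr0; lra.
  by rewrite exprS -natr1; have : 0 <= n%:R :> R by []; lra.
have -> : (25 / 16 : R) = (5 / 4) ^+ 2 by field.
rewrite -exprM mulnC exprM (_ : 16 = 4 ^+ 2) -?exprMn; last by ring.
rewrite ler_sqr ?nnegrE ?mulr_ge0 ?exprn_ge0 ?divr_ge0//.
by rewrite (le_trans _ (h b))// -natr1; lra.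
Qed.

Variables (m1 m2 : nat) (mu : probability (Sigma m1 m2) R).

(** A cell contains each of its cylinders, so the information of the cell is at
    most that of the word; the bound then concerns the distribution of words of
    length b, and does not involve a. *)
Lemma word_expectation_sqr_info a b : (a <= b)%N ->
  word_expectation mu b (fun z => info mu a b z ^+ 2) <=
  8 + 2 * (b%:R * ln #|{: letter m1 m2}|%:R) ^+ 2.
Proof.
move=> ab; set lam := #|_|%:R.
have card0 : (0 < #|{: letter m1 m2}|)%N by apply/card_gt0P; exists point.
have lam1 : 1 <= lam by rewrite ler1n.
have lam0 : 0 < lam by apply: lt_le_trans lam1.
have lamb : 1 <= lam ^+ b by rewrite exprn_ege1.
apply: (@le_trans _ _ (\sum_(t : b.-tuple (letter m1 m2))
    (8 / lam ^+ b + word_prob mu t * (2 * ln (lam ^+ b) ^+ 2)))).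
  apply: ler_sum => t _.
  have p0 := word_prob_ge0 mu t; have pc := word_prob_le_cell mu t ab.
  have c1 := cell_prob_le1 mu (seq_ext t) ab.
  have [p00|pn0] := eqVneq (word_prob mu t) 0.
    by rewrite p00 !mul0r addr0 divr_ge0// ltW// exprn_gt0.
  have {pn0} p0' : 0 < word_prob mu t by rewrite lt_neqAle eq_sym pn0.
  have := mul_sqr_ln_bound p0 (le_trans pc c1) lamb.
  rewrite [_ * (2 * _)]mulrA [_ * 2]mulrC; apply: le_trans.
  rewrite ler_wpM2l// /info sqrrN.
  have l1 : ln (word_prob mu t) <= ln (cell_prob mu a b (seq_ext t)).
    by rewrite ler_ln ?posrE// (lt_le_trans p0').
  have l2 : ln (cell_prob mu a b (seq_ext t)) <= 0 by rewrite ln_le0.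
  nra.
rewrite big_split/= sumr_const card_tuple -[X in _ *+ X]/(_ ^ _)%N.
have -> : \sum_(t : b.-tuple (letter m1 m2)) word_prob mu t * (2 * ln (lam ^+ b) ^+ 2)
    = 2 * ln (lam ^+ b) ^+ 2 by exact: (word_expectation_cst mu b).
rewrite -[X in X + _ <= _]mulr_natr natrX -/lam divfK ?gt_eqF ?exprn_gt0//.
by rewrite lnXn// -[X in _ + 2 * X ^+ 2 <= _]mulr_natl.
Qed.

Lemma info_ge0 a b z : (a <= b)%N -> 0 <= info mu a b z.
Proof. by move=> ab; rewrite oppr_ge0 ln_le0// cell_prob_le1. Qed.

Lemma depends_on_info a b : (a <= b)%N -> depends_on b (info mu a b).
Proof. by move=> ab z w zw; rewrite /info (depends_on_cell_prob mu ab zw). Qed.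

Lemma cell_entropy_ge0 a b : (a <= b)%N -> 0 <= cell_entropy mu a b.
Proof. by move=> ab; apply: word_expectation_ge0 => z; exact: info_ge0. Qed.

(** The first moment is bounded through the second one, by x <= x^2 + 1. *)
Lemma cell_moments_bound : exists2 K : R, 0 <= K & forall a b, (a <= b)%N ->
  cell_entropy mu a b <= K * (25 / 16) ^+ b /\
  word_expectation mu b (fun z => info mu a b z ^+ 2) <= K * (25 / 16) ^+ b.
Proof.
set lam := ln #|{: letter m1 m2}|%:R : R.
have l0 : 0 <= 2 * lam ^+ 2 by rewrite mulr_ge0 ?sqr_ge0.
exists ((9 + 2 * lam ^+ 2) * 16); first by rewrite mulr_ge0// addr_ge0.
move=> a b ab; have := word_expectation_sqr_info ab; rewrite -/lam => h.
have b1 : 1 <= b.+1%:R ^+ 2 :> R by rewrite exprn_ege1// ler1n.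
have h' : word_expectation mu b (fun z => info mu a b z ^+ 2) + 1 <=
    (9 + 2 * lam ^+ 2) * 16 * (25 / 16) ^+ b.
  apply: (@le_trans _ _ (9 + 2 * (b%:R * lam) ^+ 2)); first by move: h; lra.
  rewrite -mulrA; apply: (@le_trans _ _ ((9 + 2 * lam ^+ 2) * b.+1%:R ^+ 2)).
    rewrite [leRHS]mulrDl lerD//; first by lra.
    rewrite exprMn mulrCA [leRHS]mulrC ler_wpM2r//.
    by rewrite ler_sqr ?nnegrE// ler_nat.
  by rewrite ler_wpM2l ?addr_ge0// sqr_le_expr.
split; last by rewrite (le_trans _ h')// lerDl.
apply: le_trans h'; rewrite -[X in _ <= _ + X](word_expectation_cst mu b).
rewrite -word_expectationD; apply: ler_word_expectation => t.
have := info_ge0 (seq_ext t) ab; nra.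
Qed.

End SecondMoment.

(** * Counting the chains by their lengths *)
Section Counting.
Variables (R : realType) (q j : nat).
Hypothesis q_gt1 : (1 < q)%N.

Definition nondiv_count (x : nat) : nat := (x - x %/ q)%N.

Lemma sum_heads_leq M x : (x <= M)%N ->
  (\sum_(i <- heads q M) (i <= x))%N = nondiv_count x.
Proof.
move=> xM; rewrite big_filter (@big_cat_nat _ _ _ x.+1)//= [X in (_ + X)%N]big_nat_cond.
rewrite [X in (_ + X)%N]big1 ?addn0 => [|i /andP[/andP[xi _] _]]; last first.
  by rewrite leqNgt xi.
rewrite big_nat_cond (eq_bigr (fun=> 1%N)); last first.
  by move=> i /andP[/andP[_ ix] _]; rewrite -ltnS ix.
rewrite -big_nat_cond /nondiv_count; elim: x {xM} => [|x IH]; first by rewrite big_geq.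
rewrite big_mkcond/= big_nat_recr//= -big_mkcond/= IH divnS 1?ltnW//.
have := leq_div x q; case: (q %| x.+1)%N => /=; lia.
Qed.

Lemma leq_nondiv_count x y : (x <= y)%N -> (nondiv_count x <= nondiv_count y)%N.
Proof.
move=> xy; rewrite -(sum_heads_leq xy) -(sum_heads_leq (leqnn y)).
by apply: leq_sum => i _; case: (leqP i x) => // ix; rewrite (leq_trans ix xy).
Qed.

(** The number of chains with head at most x / q^p, i.e. with more than p
    positions at or before x ([tail_countE]). *)
Definition tail_count (x p : nat) : R := (nondiv_count (x %/ q ^ p))%:R.

Lemma tail_countE M x p : (x <= M)%N ->
  \sum_(i <- heads q M) (p < chain_len q x i)%:R = tail_count x p.
Proof.
move=> xM; rewrite /tail_count -(@sum_heads_leq M); last first.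
  by rewrite (leq_trans _ xM)// leq_div.
rewrite natr_sum !big_seq; apply: eq_bigr => i; rewrite mem_heads => /andP[i0 _].
by rewrite chain_lenP// leq_divRL// expn_gt0 ltnW.
Qed.

Lemma tail_count_le x p : tail_count x p <= x%:R / q%:R ^+ p.
Proof.
have qp0 : 0 < q%:R ^+ p :> R by rewrite exprn_gt0// ltr0n ltnW.
rewrite ler_pdivlMr// -natrX -natrM ler_nat.
by rewrite (leq_trans (n := (x %/ q ^ p * q ^ p)%N))// ?leq_divM// leq_mul2r leq_subr orbT.
Qed.

Lemma tail_count_ge0 x p : 0 <= tail_count x p.
Proof. exact: ler0n. Qed.

Lemma tail_count0 x p : (x <= p)%N -> tail_count x p = 0.
Proof.
move=> xp; have lt_xq : (x < q ^ p)%N := leq_ltn_trans xp (ltn_expl p q_gt1).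
by rewrite /tail_count (divn_small lt_xq) /nondiv_count div0n.
Qed.

Lemma divn_bounds x d : (0 < d)%N ->
  (x %/ d)%:R <= x%:R / d%:R :> R /\ x%:R / d%:R <= (x %/ d)%:R + 1 :> R.
Proof.
move=> d0; have dR : 0 < d%:R :> R by rewrite ltr0n.
split; first by rewrite ler_pdivlMr// -natrM ler_nat leq_divM.
by rewrite ler_pdivrMr// natr1 -natrM ler_nat ltnW// -ltn_divLR.
Qed.



(** Two roundings, each with an error of at most one. *)
Lemma tail_count_approx x p :
  `| tail_count x p - x%:R * ((1 - q%:R^-1) / q%:R ^+ p) | <= 2.
Proof.
have q0' : (0 < q)%N by rewrite ltnW.
have q0 : 0 < q%:R :> R by rewrite ltr0n.
have qp0 : (0 < q ^ p)%N by rewrite expn_gt0 q0'.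
have [h1 h2] := divn_bounds x qp0.
have [h3 h4] := divn_bounds (x %/ q ^ p) q0'.
rewrite /tail_count /nondiv_count natrB ?leq_div//.
rewrite (_ : x%:R * _ = x%:R / (q ^ p)%:R * (1 - q%:R^-1)); last first.
  by rewrite natrX; field; rewrite expf_neq0 ?gt_eqF.
move: h1 h2 h3 h4; set y := (x %/ q ^ p)%:R : R.
set z := ((_ %/ q)%:R : R); set w := x%:R / _ => h1 h2 h3 h4.
have qi0 : 0 < q%:R^-1 :> R by rewrite invr_gt0.
have qi1 : q%:R^-1 <= 1 :> R by rewrite invf_le1// ler1n.
rewrite ler_norml; apply/andP; split; nra.
Qed.

(** Only the term p = b survives: the indicators of consecutive thresholds
    cancel for p < b and vanish for p > b.  For p = b > j, the hypotheses leave
    a = b - j or a = b - j - 1, and the comparison p - j - 1 < a tells which. *)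
Lemma chain_pair_decomposition (G : nat -> nat -> R) a b N :
  (0 < b <= N)%N -> (0 < a -> a + j <= b)%N -> (b <= a + j.+1)%N ->
  G a b = \sum_(1 <= p < N.+1)
    (if (p <= j)%N then G 0%N p * ((p.-1 < b)%:R - (p < b)%:R)
     else G (p - j)%N p * ((p - j.+1 < a)%:R - (p < b)%:R) +
          G (p - j.+1)%N p * ((p.-1 < b)%:R - (p - j.+1 < a)%:R)).
Proof.
move=> /andP[b0 bN] hab hba; rewrite (bigD1_seq b) ?iota_uniq//=; last first.
  by rewrite mem_index_iota b0 ltnS.
rewrite big_seq_cond big1 ?addr0 => [|p /andP[]].
  rewrite ltnn prednK// leqnn; case: (leqP b j) => bj.
    by rewrite subr0 mulr1; congr G; case: a hab {hba} => // a /(_ isT); lia.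
  have [h|h] : a = (b - j)%N \/ a = (b - j.+1)%N.
    by case: a hab hba => [|a]; lia.
  - have -> : (b - j.+1 < a)%N by lia.
    by rewrite subr0 subrr mulr1 mulr0 addr0 -h.
  - have -> : (b - j.+1 < a)%N = false by lia.
    by rewrite !subr0 mulr0 mulr1 add0r -h.
rewrite mem_index_iota => /andP[p0 _] pb.
have [lt_pb|lt_bp] : (p < b)%N \/ (b < p)%N by lia.
  have -> : (p.-1 < b)%N by lia.
  rewrite lt_pb subrr mulr0; case: (leqP p j) => // jp.
  have -> : (p - j.+1 < a)%N by lia.
  by rewrite subrr !mulr0 addr0.
have -> : (p.-1 < b)%N = false by lia.
have -> : (p < b)%N = false by lia.
rewrite subrr mulr0; case: (leqP p j) => // jp.
have -> : (p - j.+1 < a)%N = false.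
  by case: a hab hba => [|a] // h _; have := h isT; lia.
by rewrite subrr !mulr0 addr0.
Qed.

Lemma chain_len_window n N i : (n * q ^ j <= N <= n * q ^ j.+1)%N -> (0 < i)%N ->
  (0 < chain_len q n i -> chain_len q n i + j <= chain_len q N i)%N /\
  (chain_len q N i <= chain_len q n i + j.+1)%N.
Proof.
move=> /andP[nN Nn] i0; split; last first.
  rewrite chain_len_leq// (leq_ltn_trans Nn)// expnD mulnA ltn_pmul2r; last first.
    by rewrite expn_gt0 ltnW.
  by rewrite -chain_len_leq.
case e : (chain_len q n i) => [//|a] _.
rewrite addSn chain_lenP// expnD mulnA (leq_trans _ nN)// leq_mul2r.
by rewrite -chain_lenP// e leqnn orbT.
Qed.

Lemma chain_len_le_self N i : (0 < i)%N -> (chain_len q N i <= N)%N.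
Proof.
move=> i0; rewrite chain_len_leq// (leq_trans (ltn_expl N q_gt1))//.
by rewrite leq_pmull.
Qed.

(** The contribution of the chains having p positions at or before N, when n
    and N bound the two windows.  For p > j the two products correspond to the
    chains with p - j and with p - j - 1 positions at or before n; for p <= j
    no position of the chain is at or before n. *)
Definition level_sum (G : nat -> nat -> R) (n N p : nat) : R :=
  if (p <= j)%N then G 0%N p * (tail_count N p.-1 - tail_count N p)
  else G (p - j)%N p * (tail_count n (p - j.+1) - tail_count N p) +
       G (p - j.+1)%N p * (tail_count N p.-1 - tail_count n (p - j.+1)).

Lemma sum_chains_levels (G : nat -> nat -> R) n N :
  (n * q ^ j <= N <= n * q ^ j.+1)%N ->
  \sum_(i <- heads q N) G (chain_len q n i) (chain_len q N i) =
  \sum_(1 <= p < N.+1) level_sum G n N p.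
Proof.
move=> nN; have le_nN : (n <= N)%N.
  by case/andP: nN => + _; apply: leq_trans; rewrite leq_pmulr// expn_gt0 ltnW.
rewrite big_seq; under eq_bigr => i.
  rewrite mem_heads => /and3P[i0 iN _]; have [h1 h2] := chain_len_window nN i0.
  rewrite (@chain_pair_decomposition G _ _ N)//; last first.
    by rewrite chain_len_gt0 ?i0//= chain_len_le_self.
  over.
rewrite -big_seq exchange_big; apply: eq_bigr => p _ /=.
rewrite /level_sum; case: ifP => _.
  by rewrite -mulr_sumr sumrB !(@tail_countE N).
by rewrite big_split/= -!mulr_sumr !sumrB !(@tail_countE N).
Qed.

Lemma tail_count_window n N p : (n * q ^ j <= N <= n * q ^ j.+1)%N -> (j < p)%N ->
  tail_count N p <= tail_count n (p - j.+1) <= tail_count N p.-1.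
Proof.
have q0 k : (0 < q ^ k)%N by rewrite expn_gt0 ltnW.
move=> /andP[nN Nn] jp; rewrite !ler_nat; apply/andP; split; apply: leq_nondiv_count.
  rewrite leq_divRL// -(leq_pmul2r (q0 j.+1)) (leq_trans _ Nn)//.
  by rewrite -mulnA -expnD subnK// leq_divM.
rewrite leq_divRL// (leq_trans _ nN)//.
have -> : p.-1 = (p - j.+1 + j)%N by lia.
by rewrite expnD mulnA leq_mul2r leq_divM orbT.
Qed.

(** The counts are nonnegative and together they count the chains with p
    positions, all of whose heads are at most N / q^(p-1). *)
Lemma level_sum_bound (G : nat -> nat -> R) (K : R) n N p :
  (n * q ^ j <= N <= n * q ^ j.+1)%N -> (0 < p)%N ->
  (forall a, (a <= p)%N -> 0 <= G a p <= K) ->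
  0 <= level_sum G n N p <= K * (N%:R / q%:R ^+ p.-1).
Proof.
move=> nN p0 GK.
have le_tail : tail_count N p.-1 - tail_count N p <= N%:R / q%:R ^+ p.-1.
  by rewrite (le_trans _ (tail_count_le N p.-1))// gerBl tail_count_ge0.
have K0 : 0 <= K by case/andP: (GK 0%N isT); exact: le_trans.
have dec : tail_count N p <= tail_count N p.-1.
  by rewrite ler_nat leq_nondiv_count// leq_div2l ?expn_gt0 ?leq_exp2l ?leq_pred// ltnW.
rewrite /level_sum; case: (leqP p j) => pj.
  have /andP[G0 G1] := GK 0%N isT.
  by rewrite mulr_ge0 ?subr_ge0//= ler_pM ?subr_ge0.
have /andP[t1 t2] := tail_count_window nN pj.
have /andP[G0 G1] := GK _ (leq_subr j p).
have /andP[H0 H1] := GK _ (leq_subr j.+1 p).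
rewrite addr_ge0 ?mulr_ge0 ?subr_ge0//=.
apply: le_trans (ler_wpM2l K0 le_tail).
rewrite (_ : tail_count N p.-1 - tail_count N p = (tail_count n (p - j.+1) - tail_count N p) +
  (tail_count N p.-1 - tail_count n (p - j.+1))); last by ring.
by rewrite [leRHS]mulrDr lerD// ler_wpM2r// subr_ge0.
Qed.

Lemma level_sum0 (G : nat -> nat -> R) n N p :
  (n * q ^ j <= N <= n * q ^ j.+1)%N -> (N < p)%N ->
  level_sum G n N p = 0.
Proof.
move=> nN Np; have p1 : tail_count N p.-1 = 0 by rewrite tail_count0//; lia.
have p2 : tail_count N p = 0 by rewrite tail_count0//; lia.
rewrite /level_sum; case: (leqP p j) => pj; first by rewrite p1 p2 subrr mulr0.
have := tail_count_window nN pj; rewrite p1 p2 => /le_anti <-.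
by rewrite subrr !mulr0 addr0.
Qed.

End Counting.

(** * Limit lemmas *)
Section Limits.
Variable R : realType.

Lemma geometric_tail_le (r : R) P Q : 0 <= r < 1 ->
  \sum_(P <= p < Q) r ^+ p <= r ^+ P / (1 - r).
Proof.
move=> /andP[r0 r1]; have r1' : 0 < 1 - r by rewrite subr_gt0.
have [QP|PQ] := leqP Q P; first by rewrite big_geq// divr_ge0 ?exprn_ge0// ltW.
have -> : \sum_(P <= p < Q) r ^+ p = (r ^+ P - r ^+ Q) / (1 - r).
  move: (ltnW PQ) => {PQ}; elim: Q => [|Q IH].
    by rewrite leqn0 => /eqP ->; rewrite big_geq// subrr mul0r.
  rewrite leq_eqVlt => /predU1P[->|]; first by rewrite big_geq// subrr mul0r.
  rewrite ltnS => PQ; rewrite big_nat_recr//= IH// exprS.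
  by field; rewrite gt_eqF.
by rewrite ler_pM2r ?invr_gt0// gerBl exprn_ge0.
Qed.

(** Dominated convergence for series.  The terms vanish from M n on, so the
    sum may be lengthened to contain all p < P; the part beyond a fixed P is
    bounded by a geometric tail uniformly in n, and the rest is a finite sum. *)
Lemma tannery (f : nat -> nat -> R) (g : nat -> R) (M : nat -> nat) (C r l : R) :
  0 <= r < 1 -> 0 <= C ->
  (forall n p, (0 < p)%N -> `|f n p| <= C * r ^+ p) ->
  (forall n p, (M n <= p)%N -> f n p = 0) ->
  (forall p, (0 < p)%N -> f n p @[n --> \oo] --> g p) ->
  (\sum_(1 <= p < P) g p @[P --> \oo] --> l) ->
  \sum_(1 <= p < M n) f n p @[n --> \oo] --> l.
Proof.
move=> r01 C0 fB f0 fg gl; have /andP[r0 r1] := r01.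
have r1' : 0 < 1 - r by rewrite subr_gt0.
apply/cvgrPdist_lt => e e0; have e3 : 0 < e / 3 by rewrite divr_gt0.
have tail0 : C / (1 - r) * r ^+ P @[P --> \oo] --> (0 : R).
  rewrite -[X in _ --> X](mulr0 (C / (1 - r))); apply: cvgMr.
  by apply: cvg_expr; rewrite ger0_norm.
(* a cut-off P serving both the limit series and the uniform tail *)
have [P [P0 [gP tP]]] : exists P, [/\ (0 < P)%N,
    `|l - \sum_(1 <= p < P) g p| < e / 3 & C / (1 - r) * r ^+ P < e / 3].
  move/cvgrPdist_lt: gl => /(_ _ e3) [A _ hA].
  move/cvgrPdist_lt: tail0 => /(_ _ e3) [B _ hB].
  exists (maxn 1 (maxn A B)); split; first by rewrite leq_max.
    by apply: hA; rewrite /= !leq_max leqnn orbT.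
  have := hB (maxn 1 (maxn A B)); rewrite /= !leq_max leqnn !orbT => /(_ isT).
  by rewrite sub0r normrN ger0_norm// mulr_ge0 ?divr_ge0 ?exprn_ge0// ltW.
have fin : \sum_(1 <= p < P) f n p @[n --> \oo] --> \sum_(1 <= p < P) g p.
  rewrite big_nat; under eq_fun do rewrite big_nat.
  by apply: cvg_big => [|p /andP[p0 _]]; [exact: add_continuous|exact: fg].
move/cvgrPdist_lt: fin => /(_ _ e3); apply: filterS => n fn.
have -> : \sum_(1 <= p < M n) f n p = \sum_(1 <= p < P) f n p +
    \sum_(P <= p < maxn P (M n)) f n p.
  rewrite -big_cat_nat ?leq_maxl//=.
  have [PM|MP] := leqP P (M n); first by [].
  have [M1|M1] := leqP 1 (M n).
    rewrite (big_cat_nat M1 (ltnW MP))/= [X in _ = _ + X]big_nat_cond.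
    rewrite [X in _ = _ + X]big1 ?addr0// => p /andP[/andP[Mp _] _].
    exact: f0.
  rewrite [LHS](big_geq (ltnW M1)) big_nat_cond big1 // => p /andP[/andP[p1 _] _].
  by apply: f0; exact: leq_trans (ltnW M1) p1.
have tl : `|\sum_(P <= p < maxn P (M n)) f n p| < e / 3.
  apply: le_lt_trans tP; apply: (le_trans (ler_norm_sum _ _ _)).
  apply: (@le_trans _ _ (C * \sum_(P <= p < maxn P (M n)) r ^+ p)).
    rewrite mulr_sumr; apply: ler_sum_nat => p /andP[Pp _].
    by rewrite fB// (leq_trans P0).
  by rewrite -mulrA ler_wpM2l// mulrC geometric_tail_le.
set G := \sum_(1 <= p < P) g p in gP fn *; set F := \sum_(1 <= p < P) f n p in fn *.
set t := \sum_(P <= p < _) _ in tl *.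
have -> : l - (F + t) = (l - G) + ((G - F) - t) by ring.
apply: (le_lt_trans (ler_normD _ _)).
have := ler_normB (G - F) t; move: gP fn tl; lra.
Qed.

Lemma cvg_sum_geometric_bound (u : nat -> R) (C r : R) k :
  0 <= r < 1 -> (forall p, (k <= p)%N -> 0 <= u p <= C * r ^+ p) ->
  exists l : R, \sum_(k <= p < P) u p @[P --> \oo] --> l /\
    (\sum_(k <= p <oo) (u p)%:E)%E = l%:E.
Proof.
move=> r01 ub; have /andP[r0 r1] := r01.
have cvgu : cvgn (fun P => \sum_(k <= p < P) u p).
  apply: nondecreasing_is_cvgn.
    move=> m n mn; have [km|mk] := leqP k m; last first.
      rewrite (big_geq (ltnW mk)) big_nat_cond; apply: sumr_ge0 => p.
      by move=> /andP[/andP[kp _] _]; case/andP: (ub p kp).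
    rewrite (big_cat_nat km mn)/= lerDl big_nat_cond; apply: sumr_ge0 => p.
    by move=> /andP[/andP[mp _] _]; case/andP: (ub p (leq_trans km mp)).
  exists (C * (r ^+ k / (1 - r))) => _ [n _ <-].
  apply: (@le_trans _ _ (\sum_(k <= p < n) C * r ^+ p)).
    by apply: ler_sum_nat => p /andP[kp _]; case/andP: (ub p kp).
  have C0 : 0 <= C * r ^+ k by have /andP[] := ub k (leqnn k); exact: le_trans.
  have [rk0|rk0] := eqVneq (r ^+ k) 0.
    rewrite rk0 mul0r mulr0 big_nat_cond big1// => p /andP[/andP[kp _] _].
    by rewrite -(subnKC kp) exprD rk0 mul0r mulr0.
  rewrite -mulr_sumr ler_wpM2l ?geometric_tail_le//.
  by rewrite -(pmulr_lge0 _ (_ : 0 < r ^+ k)) // lt_neqAle eq_sym rk0 exprn_ge0.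
exists (limn (fun P => \sum_(k <= p < P) u p)); split=> //.
apply: cvg_lim => //; under eq_fun do rewrite sumEFin.
apply: cvg_EFin; first exact: nearW.
exact: cvgu.
Qed.

Lemma cvg_div_bounded_error (u : nat -> R) (c C : R) :
  (forall n, `|u n - n%:R * c| <= C) -> u n / n%:R @[n --> \oo] --> c.
Proof.
move=> uc; have h0 : C * (n.+1%:R)^-1 @[n --> \oo] --> (0 : R).
  by rewrite -[X in _ --> X](mulr0 C); apply: cvgMr; exact: cvg_harmonic.
rewrite -(cvg_shiftS (fun n => u n / n%:R)) /=.
apply/cvgrPdist_le => e e0.
move/cvgrPdist_le: h0 => /(_ _ e0); apply: filterS => n; rewrite sub0r normrN.
apply: le_trans; have n0 : 0 < n.+1%:R :> R by rewrite ltr0n.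
rewrite (_ : c - _ = - ((u n.+1 - n.+1%:R * c) / n.+1%:R)); last by field; rewrite gt_eqF.
rewrite normrN normrM normfV (gtr0_norm n0).
by rewrite (le_trans _ (ler_norm _))// ler_wpM2r// invr_ge0 ltW.
Qed.

Lemma exists_sqrtn : exists s : nat -> nat, forall n, (s n ^ 2 <= n < (s n).+1 ^ 2)%N.
Proof.
suff /choice[s hs] : forall n, exists k, (k ^ 2 <= n < k.+1 ^ 2)%N by exists s.
elim=> [|n [k /andP[kn nk]]]; first by exists 0%N.
have [h|h] := leqP (k.+1 ^ 2) n.+1.
  by exists k.+1; rewrite h/= (leq_ltn_trans nk)// ltn_exp2r.
by exists k; rewrite h andbT (leq_trans kn).
Qed.

(** With s = floor (sqrt n), monotonicity squeezes a n / n between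
    a (s^2) / (s+1)^2 and a ((s+1)^2) / s^2, and (s+1)/s tends to 1. *)
Lemma cvg_of_squares (a : nat -> R) (D : R) :
  (forall n, 0 <= a n) -> {homo a : m n / (m <= n)%N >-> m <= n} ->
  a (k.+1 ^ 2)%N / (k.+1 ^ 2)%:R @[k --> \oo] --> D ->
  a n / n%:R @[n --> \oo] --> D.
Proof.
move=> a0 a_mono aD; have [s hs] := exists_sqrtn.
pose v k := a (k.+1 ^ 2)%N / (k.+1 ^ 2)%:R : R.
pose h k : R := k.+1%:R^-1.
have h0 : h k @[k --> \oo] --> (0 : R) by exact: cvg_harmonic.
have lo : v k * (1 - h k.+1) ^+ 2 @[k --> \oo] --> D.
  suff : v k * (1 - h k.+1) ^+ 2 @[k --> \oo] --> D * (1 - 0) ^+ 2.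
    by rewrite subr0 expr1n mulr1.
  apply: cvgM; first exact: aD.
  have h1 : 1 - h k.+1 @[k --> \oo] --> (1 - 0 : R).
    by apply: cvgB; [exact: cvg_cst|rewrite (cvg_shiftS h)].
  by rewrite expr2; under eq_fun do rewrite expr2; apply: cvgM.
have up : v k.+1 * (1 + h k) ^+ 2 @[k --> \oo] --> D.
  suff : v k.+1 * (1 + h k) ^+ 2 @[k --> \oo] --> D * (1 + 0) ^+ 2.
    by rewrite addr0 expr1n mulr1.
  apply: cvgM; first by rewrite (cvg_shiftS v).
  have h1 : 1 + h k @[k --> \oo] --> (1 + 0 : R).
    by apply: cvgD; [exact: cvg_cst|].
  by rewrite expr2; under eq_fun do rewrite expr2; apply: cvgM.
have s_oo : (s n).-1 @[n --> \oo] --> \oo.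
  move=> A [N _ hN]; exists (N.+2 ^ 2)%N => // n /= Nn; apply: hN => /=.
  have /andP[_ h2] := hs n; have := leq_ltn_trans Nn h2.
  by rewrite ltn_exp2r//; lia.
apply: (@squeeze_cvgr _ _ _ _ (fun n => v (s n).-1 * (1 - h (s n).-1.+1) ^+ 2)
  (fun n => v (s n).-1.+1 * (1 + h (s n).-1) ^+ 2)).
- exists 1%N => // n /= n1; have /andP[sn ns] := hs n.
  have s0 : (0 < s n)%N by case: (s n) ns => //; lia.
  rewrite /v /h prednK//.
  have sR : 0 < (s n)%:R :> R by rewrite ltr0n.
  have nR : 0 < n%:R :> R by rewrite ltr0n.
  have lo2 : (s n)%:R ^+ 2 <= n%:R :> R by rewrite -natrX ler_nat.
  have up2 : n%:R <= (s n).+1%:R ^+ 2 :> R by rewrite -natrX ler_nat ltnW.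
  have s1R : 0 < (s n).+1%:R :> R by rewrite ltr0n.
  apply/andP; split.
    rewrite (_ : _ * _ = a (s n ^ 2)%N / (s n).+1%:R ^+ 2); last first.
      rewrite natrX -[(s n).+1%:R]natr1; field.
      by rewrite natr1 !gt_eqF.
    by apply: ler_pM => //; rewrite ?invr_ge0 ?sqr_ge0 ?a_mono// lef_pV2// posrE exprn_gt0.
  rewrite (_ : _ * _ ^+ 2 = a ((s n).+1 ^ 2)%N / (s n)%:R ^+ 2); last first.
    rewrite natrX -[(s n).+1%:R]natr1; field.
    by rewrite natr1 !gt_eqF.
  apply: ler_pM => //; rewrite ?invr_ge0 ?sqr_ge0 ?ler0n// ?a_mono//; first exact: ltnW.
  by rewrite lef_pV2// posrE exprn_gt0.
- exact: (cvg_comp (fun n => (s n).-1) (fun k => v k * (1 - h k.+1) ^+ 2) s_oo lo).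
- exact: (cvg_comp (fun n => (s n).-1) (fun k => v k.+1 * (1 + h k) ^+ 2) s_oo up).
Qed.

Lemma sum_inv_sqr_le2 n : \sum_(0 <= k < n) ((k.+1 ^ 2)%:R)^-1 <= 2 :> R.
Proof.
suff h m : \sum_(0 <= k < m.+1) ((k.+1 ^ 2)%:R)^-1 <= 2 - m.+1%:R^-1 :> R.
  case: n => [|n]; first by rewrite big_geq.
  by rewrite (le_trans (h n))// gerBl.
elim: m => [|m IH]; first by rewrite big_nat1 invr1; lra.
rewrite big_nat_recr//= (le_trans (lerD IH (lexx _)))//.
rewrite natrX -[m.+2%:R]natr1; have : 0 < m.+1%:R :> R by rewrite ltr0n.
move: (m.+1%:R) => x x0; have x1 : 0 < x + 1 by lra.
rewrite -subr_ge0 (_ : _ - _ = (x * (x + 1) ^+ 2)^-1); last by field; rewrite !gt_eqF.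
by rewrite invr_ge0 mulr_ge0 ?sqr_ge0// ltW.
Qed.

(** The series of the Y k has a finite integral, hence is finite almost
    everywhere, and the terms of a convergent series tend to 0. *)
Lemma ae_cvg0_summable d (X : measurableType d) (P : probability X R)
    (Y : nat -> X -> R) (C : R) :
  (forall k, measurable_fun setT (Y k)) -> (forall k x, 0 <= Y k x) -> 0 <= C ->
  (forall k, (\int[P]_x (Y k x)%:E <= (C / (k.+1 ^ 2)%:R)%:E)%E) ->
  {ae P, forall x, Y k x @[k --> \oo] --> 0}.
Proof.
move=> mY Y0 C0 intY; pose S x := (\sum_(k <oo) (Y k x)%:E)%E.
have S0 x : (0 <= S x)%E by apply: nneseries_ge0 => k _ _; rewrite lee_fin.
have mEY k : measurable_fun setT (fun x => (Y k x)%:E) by exact/measurable_EFinP.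
have intS : (\int[P]_x S x < +oo)%E.
  rewrite /S integral_nneseries//; last by move=> k x _; rewrite lee_fin.
  apply: (@le_lt_trans _ _ (C * 2)%:E); last exact: ltry.
  apply: lime_le.
    by apply: is_cvg_nneseries => k _ _; apply: integral_ge0 => x _; rewrite lee_fin.
  near=> n; apply: (le_trans (lee_sum _ (fun k _ => intY k))).
  by rewrite sumEFin lee_fin -mulr_sumr ler_wpM2l// sum_inv_sqr_le2.
have iS : P.-integrable setT S.
  apply/integrableP; split.
    by apply: ge0_emeasurable_sum => // k x _ _; rewrite lee_fin.
  by under eq_integral => x _ do rewrite gee0_abs//.
have := integrable_ae measurableT iS; apply: filterS => x /(_ I) finS.
apply: (@cvg_series_cvg_0 _ R^o); apply: nnseries_is_cvg => //.
by rewrite ltey_eq -/(S x) finS.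
Unshelve. all: by end_near. Qed.

End Limits.

(** * The local dimension *)
Section LocalDimension.
Variables (R : realType) (q m1 m2 j : nat).
Hypotheses (q_gt1 : (1 < q)%N) (m_bounds : (1 < m2 < m1)%N).
Hypothesis j_def : q%:R ^+ j <= (gamma R m1 m2)^-1 < q%:R ^+ j.+1.
Local Notation Sigma := (Sigma m1 m2).
Local Notation gam := (gamma R m1 m2).
Local Notation L := (L R m1 m2).

Let gam0 : 0 < gam. Proof. exact: gamma_gt0. Qed.
Let q0 : 0 < q%:R :> R. Proof. by rewrite ltr0n ltnW. Qed.

Lemma L_bounds n : n%:R / gam <= (L n)%:R /\ (L n)%:R <= n%:R / gam + 1.
Proof.
have x0 : 0 <= n%:R / gam by rewrite divr_ge0// ltW.
have c0 : 0 <= Num.ceil (n%:R / gam) by rewrite -(ceil0 R) le_ceil.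
have -> : (L n)%:R = (Num.ceil (n%:R / gam))%:~R :> R.
  by rewrite /Defs.L natr_absz ger0_norm.
split; first exact: ceil_ge.
by rewrite -lerBlDr ltW// -[1]/(1%:~R) -intrB ceilB1_lt.
Qed.

(** The upper bound survives the rounding because n q^(j+1) is an integer. *)
Lemma L_window n : (n * q ^ j <= L n <= n * q ^ j.+1)%N.
Proof.
have /andP[j1 j2] := j_def; have [L1 L2] := L_bounds n.
apply/andP; split.
  rewrite -(ler_nat R) natrM natrX; apply: le_trans L1.
  by rewrite ler_wpM2l.
have c0 : 0 <= Num.ceil (n%:R / gam).
  by rewrite -(ceil0 R) le_ceil// divr_ge0// ltW.
rewrite -lez_nat gez0_abs// ceil_le_int -[X in _ <= X]/((n * q ^ j.+1)%:R).
by rewrite natrM natrX ler_wpM2l// ltW.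
Qed.

Lemma leq_L n : (n <= L n)%N.
Proof.
by have /andP[+ _] := L_window n; apply: leq_trans; rewrite leq_pmulr// expn_gt0 ltnW.
Qed.

Lemma cvg_tail_count p :
  tail_count R q n p / n%:R @[n --> \oo] --> ((1 - q%:R^-1) / q%:R ^+ p : R).
Proof. by apply: (@cvg_div_bounded_error _ _ _ 2) => n; exact: tail_count_approx. Qed.

Lemma cvg_tail_count_L p :
  tail_count R q (L n) p / n%:R @[n --> \oo] --> ((1 - q%:R^-1) / q%:R ^+ p / gam : R).
Proof.
apply: (@cvg_div_bounded_error _ _ _ 3) => n.
have := tail_count_approx R q_gt1 (L n) p; have [L1 L2] := L_bounds n.
set c := (1 - _) / _; have c0 : 0 <= c.
  by rewrite divr_ge0 ?exprn_ge0 ?subr_ge0 ?invf_le1 ?ler1n// ltnW.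
have c1 : c <= 1.
  rewrite ler_pdivrMr ?exprn_gt0// mul1r.
  apply: (@le_trans _ _ 1); first by rewrite gerBl invr_ge0 ltW.
  by rewrite exprn_ege1// ler1n ltnW.
rewrite !ler_norml => /andP[h1 h2].
have -> : n%:R * (c / gam) = n%:R / gam * c by field; rewrite gt_eqF.
move: (n%:R / gam) (tail_count _ _ _ _) (L n)%:R L1 L2 h1 h2 => x t l L1 L2 h1 h2.
apply/andP; split; nra.
Qed.

Variable mu : probability Sigma R.

(** The limit of [level_sum] divided by n, where tau p is the asymptotic
    proportion of chains with more than p positions at or before n. *)
Definition level_weight (p : nat) : R :=
  let tau p := (1 - q%:R^-1) / q%:R ^+ p in
  let H := cell_entropy mu in
  if (p <= j)%N then H 0%N p * (tau p.-1 / gam - tau p / gam)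
  else H (p - j)%N p * (tau (p - j.+1)%N - tau p / gam) +
       H (p - j.+1)%N p * (tau p.-1 / gam - tau (p - j.+1)%N).

Lemma cvg_level_sum p :
  level_sum q j (cell_entropy mu) n (L n) p / n%:R @[n --> \oo] --> level_weight p.
Proof.
rewrite /level_sum /level_weight; case: ifP => _.
  under eq_fun do rewrite -mulrA mulrBl.
  by apply: cvgMr; apply: cvgB; exact: cvg_tail_count_L.
under eq_fun do rewrite mulrDl -[X in X + _]mulrA -[X in _ + X]mulrA !mulrBl.
by apply: cvgD; apply: cvgMr; apply: cvgB;
  first [exact: cvg_tail_count_L|exact: cvg_tail_count].
Qed.

Definition expected_info n : R :=
  \sum_(i <- heads q (L n)) cell_entropy mu (chain_len q n i) (chain_len q (L n) i).

(* the growth rate 25/16 of the moments against the decay rate 1/2 of the counts *)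
Let r : R := 25 / 32.
Let r01 : 0 <= r < 1. Proof. by rewrite /r; lra. Qed.

Lemma level_sum_decay (G : nat -> nat -> R) (K : R) n p :
  (0 < p)%N -> 0 <= K -> (forall a, (a <= p)%N -> 0 <= G a p <= K * (25 / 16) ^+ p) ->
  0 <= level_sum q j G n (L n) p <= K * 2 * q%:R ^+ j.+1 * r ^+ p * n%:R.
Proof.
move=> p0 K0 GK; have /andP[h0 h1] := level_sum_bound q_gt1 (L_window n) p0 GK.
rewrite h0/=; apply: (le_trans h1).
have Ln : (L n)%:R <= n%:R * q%:R ^+ j.+1 :> R.
  by have /andP[_] := L_window n; rewrite -(ler_nat R) natrM natrX.
have q2 : (q%:R ^+ p.-1)^-1 <= 2 * (2 ^+ p)^-1 :> R.
  rewrite -{2}(prednK p0) exprS invfM mulrA divff// mul1r.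
  by rewrite lef_pV2 ?posrE ?exprn_gt0// lerXn2r ?nnegrE// ler_nat.
have rp : r ^+ p = (25 / 16) ^+ p * (2 ^+ p)^-1.
  by rewrite -exprVn -exprMn; congr (_ ^+ _); rewrite /r; field.
rewrite rp (_ : _ * _ * n%:R = K * (25 / 16) ^+ p *
  ((n%:R * q%:R ^+ j.+1) * (2 * (2 ^+ p)^-1))); last by ring.
rewrite ler_wpM2l//; first by rewrite mulr_ge0// exprn_ge0// divr_ge0.
by rewrite ler_pM// invr_ge0 exprn_ge0// ltW.
Qed.

Lemma cvg_expected_info (l : R) :
  \sum_(1 <= p < P) level_weight p @[P --> \oo] --> l ->
  expected_info n / n%:R @[n --> \oo] --> l.
Proof.
move=> hl; have [K K0 HK] := cell_moments_bound mu.
have HK' a p : (a <= p)%N -> 0 <= cell_entropy mu a p <= K * (25 / 16) ^+ p.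
  by move=> ap; rewrite cell_entropy_ge0//= (HK a p ap).1.
have -> : (fun n => expected_info n / n%:R) = fun n =>
    \sum_(1 <= p < (L n).+1) level_sum q j (cell_entropy mu) n (L n) p / n%:R.
  by apply/funext => n; rewrite -mulr_suml /expected_info (sum_chains_levels q_gt1 _ (L_window n)).
have C0 : 0 <= K * 2 * q%:R ^+ j.+1 by rewrite !mulr_ge0 ?exprn_ge0// ltW.
apply: (@tannery _ _ level_weight (fun n => (L n).+1)
  (K * 2 * q%:R ^+ j.+1) r l r01 C0 _ _ (fun p _ => @cvg_level_sum p) hl).
  move=> n p p0; have /andP[h0 h1] := level_sum_decay n p0 K0 (fun a => HK' a p).
  rewrite ger0_norm ?mulr_ge0 ?invr_ge0//.
  case: n h0 h1 => [|n] h0 h1.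
    by rewrite invr0 mulr0 mulr_ge0// exprn_ge0//; case/andP: r01.
  by rewrite ler_pdivrMr// ltr0n.
by move=> n p Lp; rewrite (level_sum0 q_gt1 _ (L_window n) Lp)// mul0r.
Qed.

Variable P : probability Sigma R.
Hypothesis PmuP : is_Pmu q mu P.

Definition ball_info n (z : Sigma) : R :=
  \sum_(i <- heads q (L n)) info mu (chain_len q n i) (chain_len q (L n) i) (chain q z i).

Lemma depends_on_ball_info n : depends_on (L n) (ball_info n).
Proof.
move=> z w zw; rewrite /ball_info !big_seq; apply: eq_bigr => i /heads_gt0 i0.
apply: depends_on_info; first exact: chain_len_mono (leq_L n) i0.
exact: chain_depends_on.
Qed.

(** The counting lemmas apply to the bounds on the second moments just as they
    do to the entropies. *)
Lemma variance_ball_info : exists2 C : R, 0 <= C & forall n,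
  word_expectation P (L n) (fun z => (ball_info n z - expected_info n) ^+ 2) <=
  C * n%:R.
Proof.
have [K K0 HK] := cell_moments_bound mu.
have /andP[r0 r1] := r01.
have C0 : 0 <= K * 2 * q%:R ^+ j.+1 by rewrite !mulr_ge0 ?exprn_ge0// ltW.
exists (K * 2 * q%:R ^+ j.+1 * (r ^+ 1 / (1 - r))).
  by rewrite mulr_ge0// divr_ge0 ?exprn_ge0// subr_ge0 ltW.
move=> n.
apply: (@le_trans _ _ (\sum_(i <- heads q (L n)) K * (25 / 16) ^+ chain_len q (L n) i)).
  apply: le_trans (variance_sum_chains q_gt1 PmuP _) _.
    move=> i /heads_gt0 i0; apply: depends_on_info.
    exact: chain_len_mono (leq_L n) i0.
  rewrite big_seq [leRHS]big_seq; apply: ler_sum => i /heads_gt0 i0.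
  exact: (HK _ _ (chain_len_mono q_gt1 (leq_L n) i0)).2.
rewrite (sum_chains_levels q_gt1 (fun _ p => K * (25 / 16) ^+ p) (L_window n)).
apply: (@le_trans _ _ (\sum_(1 <= p < (L n).+1) K * 2 * q%:R ^+ j.+1 * r ^+ p * n%:R)).
  apply: ler_sum_nat => p /andP[p0 _].
  have := @level_sum_decay (fun _ p => K * (25 / 16) ^+ p) K n p p0 K0.
  move=> /(_ _)/andP[]// a _; rewrite lexx andbT mulr_ge0// exprn_ge0// divr_ge0.
by rewrite -mulr_suml -mulr_sumr ler_wpM2r// ler_wpM2l// geometric_tail_le.
Qed.

Lemma ae_cvg_ball_info_squares (l : R) :
  expected_info n / n%:R @[n --> \oo] --> l ->
  {ae P, forall z, ball_info (k.+1 ^ 2)%N z / (k.+1 ^ 2)%:R @[k --> \oo] --> l}.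
Proof.
move=> hl; have [C C0 varC] := variance_ball_info.
(* the normalized squared deviation along the squares *)
pose Y k z := ((ball_info (k.+1 ^ 2)%N z - expected_info (k.+1 ^ 2)%N) /
  (k.+1 ^ 2)%:R) ^+ 2.
have dY k : depends_on (L (k.+1 ^ 2)) (Y k).
  by move=> z w zw; rewrite /Y (depends_on_ball_info zw).
have Y0 k z : 0 <= Y k z by rewrite sqr_ge0.
have := @ae_cvg0_summable R _ _ P Y C (fun k => depends_on_measurable (dY k)) Y0 C0.
have intY k : (\int[P]_z (Y k z)%:E <= (C / (k.+1 ^ 2)%:R)%:E)%E.
  rewrite (integral_word_expectation _ (dY k) (Y0 k)) lee_fin.
  have n0 : 0 < (k.+1 ^ 2)%:R :> R by rewrite ltr0n expn_gt0.
  have -> : Y k = fun z => ((k.+1 ^ 2)%:R ^- 2) *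
      (ball_info (k.+1 ^ 2) z - expected_info (k.+1 ^ 2)) ^+ 2.
    by apply/funext => z; rewrite /Y exprMn exprVn mulrC.
  rewrite word_expectationZ mulrC ler_pdivrMr ?exprn_gt0//.
  by rewrite expr2 mulrA divfK ?gt_eqF.
move=> /(_ intY); apply: filterS => z Yz.
have hsq : (fun k : nat => (k.+1 ^ 2)%N) k @[k --> \oo] --> \oo.
  move=> A [N _ hN]; exists N => // k /= Nk; apply: hN => /=.
  by rewrite (leq_trans Nk)// (leq_trans (leqnSn k))// leq_pmulr.
have hE := cvg_comp _ _ hsq hl.
rewrite -[l]add0r.
have -> : (fun k => ball_info (k.+1 ^ 2)%N z / (k.+1 ^ 2)%:R) = fun k =>
    (ball_info (k.+1 ^ 2)%N z - expected_info (k.+1 ^ 2)%N) / (k.+1 ^ 2)%:R +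
    expected_info (k.+1 ^ 2)%N / (k.+1 ^ 2)%:R.
  by apply/funext => k; rewrite -mulrDl subrK.
apply: cvgD; last exact: hE.
apply/cvgrPdist_lt => e e0; move/cvgrPdist_lt: Yz => /(_ (e ^+ 2)).
rewrite exprn_gt0// => /(_ isT); apply: filterS => k.
rewrite !sub0r !normrN /Y normrX ltr_sqr ?nnegrE//; exact: ltW.
Qed.

(** The points whose ball is null form a finite union of null balls.  This is
    needed to take logarithms: [ln] is 0 at 0, so [ball_infoE] may fail where
    the ball is null. *)
Lemma ae_ball_pos : {ae P, forall z, forall n, 0 < cell_prob P n (L n) z}.
Proof.
apply: ae_foralln => n; have nL := leq_L n.
pose A : set Sigma := [set z | cell_prob P n (L n) z = 0].
have dA : depends_on (L n) A.
  by move=> z w zw; rewrite /A/= (depends_on_cell_prob P nL zw).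
exists A; split.
- exact: depends_on_measurable_set dA.
- apply: etrans (measure_word_expectation P dA) _.
  rewrite /word_expectation big1// => t _.
  rewrite indicE; case: (boolP (_ \in A)) => [/set_mem At|_]; last by rewrite mulr0.
  rewrite mulr1; apply/eqP; rewrite eq_le word_prob_ge0 andbT.
  by rewrite -At word_prob_le_cell.
- move=> z /= /negP; rewrite -leNgt => h; apply/eqP.
  by rewrite eq_le h cell_prob_ge0.
Qed.

Lemma ball_infoE n z : (0 < n)%N -> 0 < cell_prob P n (L n) z ->
  - ln (cell_prob P n (L n) z) = ball_info n z.
Proof.
move=> n0 pos; have L0 : (0 < L n)%N by rewrite (leq_trans n0) ?leq_L.
move: pos; rewrite (cell_prob_chains q_gt1 PmuP z (leq_L n) L0) /ball_info.
elim: (heads q (L n)) => [|i s IH]; first by rewrite !big_nil ln1 oppr0.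
rewrite !big_cons => h.
have p0 := cell_prob_ge0 mu (chain_len q n i) (chain_len q (L n) i) (chain q z i).
have x0 : 0 < cell_prob mu (chain_len q n i) (chain_len q (L n) i) (chain q z i).
  rewrite lt_neqAle p0 andbT; apply/negP => /eqP e.
  by move: h; rewrite -e mul0r ltxx.
move: h; rewrite pmulr_rgt0// => h.
by rewrite lnM ?posrE// opprD IH.
Qed.

(** Almost everywhere all balls have positive measure, - ln of their measure is
    [ball_info], and its normalization converges along the squares; it is
    monotone as the balls decrease. *)
Lemma exact_dimensional_lim (l : R) :
  \sum_(1 <= p < P) level_weight p @[P --> \oo] --> l ->
  exact_dimensional P (l / ln m1%:R).
Proof.
move=> /cvg_expected_info/ae_cvg_ball_info_squares hsq.
have := ae_ball_pos; rewrite /exact_dimensional.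
move: hsq; apply: filterS2 => z hz pos.
pose a n := - ln (cell_prob P n (L n) z).
have ballE n : P (ball_at R n z) = (cell_prob P n (L n) z)%:E.
  by rewrite ball_atE// -cell_probE ?leq_L.
have a0 n : 0 <= a n by rewrite oppr_ge0 ln_le0// cell_prob_le1// leq_L.
have a_mono : {homo a : m n / (m <= n)%N >-> m <= n}.
  move=> m n mn; rewrite lerN2 ler_ln ?posrE//.
  rewrite -lee_fin -!ballE; apply: le_measure.
  - by rewrite inE ball_atE//; exact: depends_on_measurable_set (depends_on_cell _ (leq_L n)).
  - by rewrite inE ball_atE//; exact: depends_on_measurable_set (depends_on_cell _ (leq_L m)).
  - move=> w /= h; apply: (le_trans h).
    have m1_0 : (0 < m1)%N by case/andP: m_bounds => _; case: (m1).
    have m1R : 1 <= m1%:R :> R by rewrite ler1n.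
    by rewrite lef_pV2 ?posrE ?exprn_gt0 ?ltr0n// ler_weXn2l.
have al : a n / n%:R @[n --> \oo] --> l.
  apply: cvg_of_squares => //; move: hz.
  by under eq_fun => k do rewrite -ball_infoE ?expn_gt0//.
have -> : (fun n => (- (n%:R^-1 / ln m1%:R)%:E * lne (P (ball_at R n z)))%E) =
    fun n => (a n / n%:R / ln m1%:R)%:E.
  apply/funext => n; rewrite ballE lne_EFin// -EFinN -EFinM; congr EFin.
  by rewrite /a; ring.
apply: cvg_EFin; first exact: nearW.
rewrite (_ : fine \o _ = fun n => a n / n%:R / ln m1%:R)//.
by apply: cvgMl.
Qed.

End LocalDimension.

(** * The dimension formula *)
Theorem theorem2p2 (R : realType) (q m1 m2 j : nat)
    (q_ge2 : (2 <= q)%N) (m2_ge2 : (2 <= m2)%N) (lt_m2m1 : (m2 < m1)%N)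
    (j_def : q%:R ^+ j <= (gamma R m1 m2)^-1 < q%:R ^+ j.+1)
    (Omega : set (Sigma m1 m2))
    (Omega_neq0 : Omega !=set0) (Omega_closed : closed Omega)
    (mu : probability (Sigma m1 m2) R) (mu_Omega : mu Omega = 1%E)
    (Pmu : probability (Sigma m1 m2) R) (PmuP : is_Pmu q mu Pmu) :
  exists2 D : R, exact_dimensional Pmu D &
    (D%:E =
      ((q%:R - 1) ^+ 2)%:E *
        (\sum_(1 <= p < j.+1)
          (entropy mu (alpha1 Omega p) / q%:R ^+ p.+1)%:E) +
      ((q%:R - 1) * (q%:R ^+ j.+1 * gamma R m1 m2 - 1))%:E *
        (\sum_(j.+1 <= p <oo)
          (entropy mu (refinement (alpha2 Omega (p - j)) (alpha1 Omega p))
            / q%:R ^+ p.+1)%:E) +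
      ((q%:R - 1) * (1 - q%:R ^+ j * gamma R m1 m2))%:E *
        (\sum_(j.+1 <= p <oo)
          (entropy mu (refinement (alpha2 Omega (p - j.+1)) (alpha1 Omega p))
            / q%:R ^+ p)%:E))%E.
Proof.
have m_bounds : (1 < m2 < m1)%N by rewrite m2_ge2.
have q0 : 0 < q%:R :> R by rewrite ltr0n (leq_trans _ q_ge2).
have lm2 : 0 < ln m2%:R :> R by rewrite ln_gt0// ltr1n.
have lm1 : 0 < ln m1%:R :> R by rewrite ln_gt0// ltr1n (ltn_trans m2_ge2).
pose H := cell_entropy mu.
pose u1 p := entropy mu (alpha1 Omega p) / q%:R ^+ p.+1.
pose u2 p := entropy mu (refinement (alpha2 Omega (p - j)) (alpha1 Omega p)) / q%:R ^+ p.+1.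
pose u3 p := entropy mu (refinement (alpha2 Omega (p - j.+1)) (alpha1 Omega p)) / q%:R ^+ p.
have u1E p : u1 p = H 0%N p / ln m2%:R / q%:R ^+ p.+1.
  rewrite /u1 -(refinement_alpha2_0 p Omega_neq0).
  by rewrite (entropy_refinement Omega_closed mu_Omega).
have u2E p : u2 p = H (p - j)%N p / ln m2%:R / q%:R ^+ p.+1.
  by rewrite /u2 (entropy_refinement Omega_closed mu_Omega)// leq_subr.
have u3E p : u3 p = H (p - j.+1)%N p / ln m2%:R / q%:R ^+ p.
  by rewrite /u3 (entropy_refinement Omega_closed mu_Omega)// leq_subr.
have [K K0 HK] := cell_moments_bound mu.
have r01 : 0 <= (25 / 32 : R) < 1 by lra.
have decay a p k : (a <= p)%N -> (p <= k)%N ->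
    0 <= H a p / ln m2%:R / q%:R ^+ k <= K / ln m2%:R * (25 / 32) ^+ p.
  move=> ap pk; have h0 : 0 <= H a p by exact: cell_entropy_ge0.
  apply/andP; split; first by rewrite !divr_ge0 ?exprn_ge0// ltW.
  rewrite (_ : 25 / 32 = 25 / 16 / 2); last by field.
  rewrite expr_div_n mulrAC [leRHS]mulrAC ler_pM2r ?invr_gt0//.
  rewrite mulrA ler_pM ?(HK a p ap).1//.
  rewrite lef_pV2 ?posrE ?exprn_gt0// (le_trans (y := q%:R ^+ p))//.
    by rewrite lerXn2r ?nnegrE// ler_nat.
  by rewrite ler_weXn2l// ler1n ltnW.
have [l2 [cvg2 sum2]] : exists l : R, \sum_(j.+1 <= p < P) u2 p @[P --> \oo] --> l /\
    (\sum_(j.+1 <= p <oo) (u2 p)%:E)%E = l%:E.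
  apply: (cvg_sum_geometric_bound (C := K / ln m2%:R) r01) => p _.
  by rewrite u2E decay ?leq_subr.
have [l3 [cvg3 sum3]] : exists l : R, \sum_(j.+1 <= p < P) u3 p @[P --> \oo] --> l /\
    (\sum_(j.+1 <= p <oo) (u3 p)%:E)%E = l%:E.
  apply: (cvg_sum_geometric_bound (C := K / ln m2%:R) r01) => p _.
  by rewrite u3E decay ?leq_subr.
set c2 := (q%:R - 1) * (q%:R ^+ j.+1 * _ - 1); set c3 := (q%:R - 1) * (1 - _).
pose D := (q%:R - 1) ^+ 2 * (\sum_(1 <= p < j.+1) u1 p) + c2 * l2 + c3 * l3.
exists D; last by rewrite sum2 sum3 sumEFin -!EFinM -!EFinD.
(* comparison of the limit weights with the terms of the formula: gamma converts
   the logarithms to the base m2 into logarithms to the base m1 *)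
have weight_low p : (0 < p <= j)%N ->
    level_weight q j mu p = ln m1%:R * ((q%:R - 1) ^+ 2 * u1 p).
  case: p => // p /andP[_ pj]; rewrite u1E /level_weight pj /gamma !exprS -/H.
  by field; rewrite !gt_eqF// exprn_gt0.
have weight_high p : (j < p)%N ->
    level_weight q j mu p = ln m1%:R * (c2 * u2 p + c3 * u3 p).
  move=> jp; rewrite u2E u3E /level_weight leqNgt jp/= -/H /c2 /c3 /gamma.
  have -> : p.-1 = (p - j.+1 + j)%N by lia.
  have -> : p.+1 = (p - j.+1 + j).+2 by lia.
  have e : (p - j.+1 + j).+1 = p by lia.

  move: (H (p - j)%N p) (H (p - j.+1)%N p) => H2 H3.
  have -> : q%:R ^+ p = q%:R * (q%:R ^+ (p - j.+1) * q%:R ^+ j) :> R.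
    by rewrite -exprD -exprS e.
  rewrite !exprS exprD.
  by field; rewrite !gt_eqF// ?exprn_gt0.
have -> : D = ln m1%:R * D / ln m1%:R by rewrite mulrAC divff ?mul1r// gt_eqF.
apply: (exact_dimensional_lim q_ge2 m_bounds j_def PmuP).
have cvgD : (ln m1%:R * ((q%:R - 1) ^+ 2 * (\sum_(1 <= p < j.+1) u1 p) +
    c2 * (\sum_(j.+1 <= p < P) u2 p) + c3 * (\sum_(j.+1 <= p < P) u3 p)))
    @[P --> \oo] --> ln m1%:R * D.
  apply: cvgMr; apply: cvgD; last exact: cvgMr.
  by apply: cvgD; [exact: cvg_cst|exact: cvgMr].
apply: cvg_trans cvgD; apply: near_eq_cvg; exists j.+1 => // P /= jP.
rewrite (big_cat_nat (_ : 1 <= j.+1)%N jP)//= -addrA mulrDr; congr (_ + _).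
  by rewrite !mulr_sumr; apply: eq_big_nat => p; rewrite ltnS => /weight_low ->.
rewrite !mulr_sumr -big_split/= mulr_sumr.
by apply: eq_big_nat => p /andP[/weight_high -> _].
Qed.
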